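(* Let $n$ be an odd prime. Then there exists a cellular biembedding of $K_{3\times n^2}$ into an orientable surface such that every face has length $3n^2$ or $3n^3$.
   Context: $K_{q\times r}$ denotes the complete multipartite graph with $q$ parts each of size $r$. An embedding of a graph $\Gamma$ (as a $1$-dimensional simplicial complex) in a surface $\Sigma$ is a continuous injective map $\phi:\Gamma\to\Sigma$; the connected components of $\Sigma\setminus\phi(\Gamma)$ are its faces; the embedding is cellular if every face is homeomorphic to an open disc. A circuit decomposition of a graph is a set of circuits (closed trails, without repeated edges but possibly with repeated vertices) whose edge-sets partition the edge-set. A biembedding of two circuit decompositions $\mathcal{D},\mathcal{D}'$ of a simple graph $\Gamma$ is a face $2$-colorable embedding of $\Gamma$ in which (the boundaries of the faces of) one color class are the circuits of $\mathcal{D}$ and those of the other color class are the circuits of $\mathcal{D}'$. A biembedding of $\Gamma$ means a biembedding of some two circuit decompositions of $\Gamma$. The length of a face is the number of edges of its boundary circuit. *)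

(* Defs.v *)
From HB Require Import structures.
From mathcomp Require Import all_boot all_order all_algebra.
From mathcomp Require Import all_classical all_reals all_analysis.

Set Implicit Arguments.
Unset Strict Implicit.
Unset Printing Implicit Defensive.

Import Order.TTheory GRing.Theory Num.Theory.
Import numFieldNormedType.Exports.

Local Open Scope classical_set_scope.
Local Open Scope ring_scope.

(* Simple graphs are symmetric irreflexive relations on a finType. *)
Section Graphs.
Variables (V : finType) (e : rel V).

Definition edge_set : {set {set V}} :=
  [set [set p.1; p.2] | p in [pred p : V * V | e p.1 p.2]]%SET.

(* A closed walk is given by the list of its vertices in cyclic order, its last
   vertex being joined to its first one; its edges are listed in the order in
   which they are traversed, and [size c] is their number. *)
Definition circuit_edges (c : seq V) : seq {set V} :=
  [seq [set p.1; p.2]%SET | p <- zip c (rot 1 c)].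

Definition circuit (c : seq V) : bool :=
  [&& c != [::], cycle e c & uniq (circuit_edges c)].

Definition circuit_decomposition (D : seq (seq V)) : bool :=
  all circuit D && perm_eq (flatten (map circuit_edges D)) (enum edge_set).

End Graphs.

(* The adjacency relation of the complete multipartite graph with q parts of
   size r; the first component of a vertex is its part. *)
Definition complete_multipartite (q r : nat) : rel ('I_q * 'I_r) :=
  fun x y => x.1 != y.1.

Definition homeomorphism (X Y : topologicalType) (A : set X) (B : set Y)
    (f : X -> Y) (g : Y -> X) : Prop :=
  [/\ f @` A = B, {in A, cancel f g},
      {within A, continuous f} & {within B, continuous g}].

Notation plane R := (R * R)%type.

Section Plane.
Variable R : realType.

(* The library's norm on R * R is the sup norm, hence the explicit formulas. *)
Definition closed_disc (p : plane R) (r : R) : set (plane R) :=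
  [set q | (q.1 - p.1) ^+ 2 + (q.2 - p.2) ^+ 2 <= r ^+ 2].

Definition open_disc (p : plane R) (r : R) : set (plane R) :=
  [set q | (q.1 - p.1) ^+ 2 + (q.2 - p.2) ^+ 2 < r ^+ 2].

Definition origin : plane R := (0, 0).

Definition circle_point (t : R) : plane R := (cos t, sin t).

(* The image under h of the circle of centre p and radius r, traversed
   counterclockwise, winds exactly once counterclockwise around h p: theta is a
   continuous determination of the angle of h - h p along it, rho its modulus. *)
Definition winds_once (h : plane R -> plane R) (p : plane R) (r : R) : Prop :=
  exists theta rho : R -> R,
    [/\ continuous theta,
        forall t, theta (t + 2 * pi) = theta t + 2 * pi,
        forall t, 0 < rho t &
        forall t, h (p + r *: circle_point t) =
                  h p + rho t *: circle_point (theta t)].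

(* Meant for a homeomorphism h from the open set W onto an open set: h has
   local degree 1 at each point of W. For such an h, whether [winds_once h p r]
   holds does not depend on r as long as the closed disc lies in W. *)
Definition orientation_preserving (W : set (plane R)) (h : plane R -> plane R)
    : Prop :=
  forall p, W p -> exists r : R,
    [/\ 0 < r, closed_disc p r `<=` W & winds_once h p r].

End Plane.

Section Surfaces.
Variables (R : realType) (S : topologicalType).

Record chart := Chart {
  chart_dom : set S;
  chart_map : S -> plane R;
  chart_inv : plane R -> S;
  chart_dom_open : open chart_dom;
  chart_img_open : open (chart_map @` chart_dom);
  chart_homeo :
    homeomorphism chart_dom (chart_map @` chart_dom) chart_map chart_inv }.

(* Surfaces are closed and connected, as usual for graph embeddings; second
   countability follows from compactness. *)
Definition surface : Prop :=
  [/\ hausdorff_space S, compact [set: S], connected [set: S] &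
      forall x : S, exists c : chart, chart_dom c x].

Definition orientable : Prop :=
  exists A : set chart,
    (forall x : S, exists2 c, A c & chart_dom c x) /\
    (forall c d, A c -> A d ->
       orientation_preserving (chart_map c @` (chart_dom c `&` chart_dom d))
                              (chart_map d \o chart_inv c)).

End Surfaces.

Section Embeddings.
Variables (R : realType) (V : finType) (e : rel V).

(* Geometric realization of the graph as a 1-dimensional simplicial complex,
   in barycentric coordinates. *)
Definition edge_point (u v : V) (t : R) : {ptws V -> R} :=
  fun w => (1 - t) * (w == u)%:R + t * (w == v)%:R.

Definition vertex_point (v : V) : {ptws V -> R} := fun w => (w == v)%:R.

Definition edge_segment (u v : V) : set {ptws V -> R} :=
  [set edge_point u v t | t in [set t : R | 0 <= t <= 1]].

Definition realization : set {ptws V -> R} :=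
  [set x | (exists v, x = vertex_point v) \/
           (exists u v, e u v /\ edge_segment u v x)].

Variable S : topologicalType.

(* Only the restriction of phi to the realization is meaningful. *)
Variable phi : {ptws V -> R} -> S.

Definition embedding : Prop :=
  {within realization, continuous phi} /\ {in realization &, injective phi}.

Definition face (F : set S) : Prop :=
  exists2 x, ~ (phi @` realization) x &
    F = connected_component (~` (phi @` realization)) x.

Definition cellular : Prop :=
  forall F, face F ->
    exists f g, homeomorphism (@open_disc R (origin R) 1) F f g.

(* The face F is bounded by the closed walk c: F is the homeomorphic image of
   the open disc under a map psi which extends continuously to the closed disc
   and whose restriction to the unit circle, divided into [size c] equal arcs,
   runs along the successive edges of c. The sense of traversal is arbitrary,
   as psi may reverse the orientation. *)
Definition bounded_by (F : set S) (c : seq V) : Prop :=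
  exists (psi : plane R -> S) (g : S -> plane R),
    [/\ {within closed_disc (origin R) 1, continuous psi},
        homeomorphism (open_disc (origin R) 1) F psi g &
        forall (x0 : V) (j : nat) (t : R), (j < size c)%N -> 0 <= t <= 1 ->
          psi (circle_point (2 * pi * (j%:R + t) / (size c)%:R)) =
          phi (edge_point (nth x0 c j) (nth x0 (rot 1 c) j) t)].

Definition face_length (F : set S) (l : nat) : Prop :=
  exists c : seq V, [/\ circuit e c, bounded_by F c & size c = l].

Definition face_coloring (col : set S -> bool) : Prop :=
  forall (F F' : set S) (u v : V), face F -> face F' -> F <> F' -> e u v ->
    phi @` edge_segment u v `<=` closure F ->
    phi @` edge_segment u v `<=` closure F' ->
    col F <> col F'.

Definition color_class_is (col : set S -> bool) (b : bool) (D : seq (seq V))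
    : Prop :=
  (forall F, face F -> col F = b -> exists2 c, c \in D & bounded_by F c) /\
  (forall c, c \in D -> exists F, [/\ face F, col F = b & bounded_by F c]).

Definition biembedding_of (D D' : seq (seq V)) : Prop :=
  embedding /\
  exists col : set S -> bool,
    [/\ face_coloring col, color_class_is col true D &
        color_class_is col false D'].

Definition biembedding : Prop :=
  exists D D' : seq (seq V),
    [/\ circuit_decomposition e D, circuit_decomposition e D' &
        biembedding_of D D'].

End Embeddings.

(* Main.v *)
(* Put N = n^2, which is odd, and take Z_3 x Z_N for the vertices. For each d
   in Z_N the edges are distributed among the Hamiltonian circuits
     B_d = (0,y), (1,y+d), (2,y+2d),   (0,y+1), ...
     W_d = (0,y), (1,y+d), (2,y+2d+2), (0,y+1), ...
   so that every arc from part i to part i+1 lies on one B and on one W. Gluing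
   discs along the B's, and along the W's traversed backwards, gives an oriented
   surface: since 2 is invertible modulo N, the faces around each vertex form a
   single cycle, and all faces have length 3N.

   As the circuits are Hamiltonian, coning each of them off yields a simplicial
   complex, and the surface is its realization in R^(vertices and faces), where
   the graph sits as a subcomplex. The charts are the open stars, mapped linearly
   to polygons. For adjacent centres w, w', with A and A' the two other vertices
   of the triangles on the edge ww', the cross product of the chart with the
   direction of this edge is a positive multiple of x_A - x_A' in both charts,
   which is why the transition maps have degree 1. *)
Require Import Defs.
From HB Require Import structures.
From mathcomp Require Import all_boot all_order all_algebra.
From mathcomp Require Import all_classical all_reals all_analysis.
From mathcomp Require Import ring lra zify.

Set Implicit Arguments.
Unset Strict Implicit.
Unset Printing Implicit Defensive.

Import Order.TTheory GRing.Theory Num.Theory.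
Import numFieldNormedType.Exports.

Local Open Scope classical_set_scope.
Local Open Scope ring_scope.

(** * Angles and sectors in the plane *)

(** The offset 2 in W_d comes from the rotation at the vertices. With t in its place, passing from
    one B to the next around a vertex of part 0, 1 or 2 changes d by t/2, t or t/2, up to sign. So t
    has to be a unit modulo N, and t = 2 makes these steps the integers 1, 2, 1. Each star is
    parametrized twice. The charts are linear on triangles, so that barycentric coordinates control
    the transition maps; the discs are round, because the unit circle has to run along each boundary
    edge at constant speed. Degree 1 is then a matter of signs: if the image of a circle never
    points opposite to a vector turning once, its angle stays within pi of that of this vector. *)

Section RealFunctions.
Variable R : realType.

Section ContinuousOperations.
Variable T : topologicalType.
Implicit Types f g : T -> R.

Lemma cts_add f g : continuous f -> continuous g ->
  continuous (fun x => f x + g x).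
Proof. by move=> fc gc x; apply: cvgD; [exact: fc|exact: gc]. Qed.

Lemma cts_sub f g : continuous f -> continuous g ->
  continuous (fun x => f x - g x).
Proof. by move=> fc gc x; apply: cvgB; [exact: fc|exact: gc]. Qed.

Lemma cts_mul f g : continuous f -> continuous g ->
  continuous (fun x => f x * g x).
Proof. by move=> fc gc x; apply: cvgM; [exact: fc|exact: gc]. Qed.

Lemma cts_inv f : continuous f -> (forall x, f x != 0) ->
  continuous (fun x => (f x)^-1).
Proof. by move=> fc f0 x; apply: cvgV; [exact: f0|exact: fc]. Qed.

Lemma cts_comp f (h : R -> R) : continuous f -> continuous h ->
  continuous (fun x => h (f x)).
Proof.
by move=> fc hc x; apply: (@continuous_comp _ _ _ f h); [exact: fc|exact: hc].
Qed.

Lemma cts_cst (a : R) : continuous (fun _ : T => a).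
Proof. by move=> x; exact: cvg_cst. Qed.

Lemma cts_exp f n : continuous f -> continuous (fun x => f x ^+ n).
Proof.
by move=> fc; apply: (cts_comp (h := fun x => x ^+ n)) => //; exact: exprn_continuous.
Qed.

Lemma cts_max f g : continuous f -> continuous g ->
  continuous (fun x => Num.max (f x) (g x)).
Proof. by move=> fc gc; exact: max_fun_continuous. Qed.

Lemma cts_min f g : continuous f -> continuous g ->
  continuous (fun x => Num.min (f x) (g x)).
Proof. by move=> fc gc; exact: min_fun_continuous. Qed.

Lemma continuous_sum (I : Type) (r : seq I)
    (f : I -> T -> R) : (forall i, continuous (f i)) ->
  continuous (fun x => \sum_(i <- r) f i x).
Proof.
move=> fc; apply: (@continuous_big _ _ _ _ xpredT) => [|i _]; last exact: fc.
exact: add_continuous.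
Qed.

End ContinuousOperations.

(* The branch of the angle of (x, y) in (-pi, pi). *)
Lemma half_angle (x y : R) : x ^+ 2 + y ^+ 2 = 1 -> -1 < x ->
  cos (2 * atan (y / (1 + x))) = x /\ sin (2 * atan (y / (1 + x))) = y.
Proof.
move=> xy1 x1; set T := y / (1 + x); set a := atan T.
have x0 : 1 + x != 0 by apply: lt0r_neq0; lra.
have xT : T * (1 + x) = y by rewrite /T divfK.
have ca0 : 0 < cos a.
  by apply: cos_gt0_pihalf; rewrite atan_gtNpi2 atan_ltpi2.
have saE : sin a = T * cos a.
  by rewrite -[T in RHS]atanK /tan divfK // gt_eqF.
have := cos2Dsin2 a; rewrite saE => c2.
have c2E : cos a ^+ 2 * 2 = 1 + x.
  apply: (mulfI x0); have -> : (1 + x) * (1 + x) = (1 + x) * (1 + x) *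
    (cos a ^+ 2 + (T * cos a) ^+ 2) by rewrite c2 mulr1.
  transitivity (cos a ^+ 2 * ((1 + x) ^+ 2 + (T * (1 + x)) ^+ 2)); last by ring.
  rewrite xT (_ : y ^+ 2 = 1 - x ^+ 2); last by rewrite -xy1; ring.
  by ring.
have -> : 2 * a = a *+ 2 by rewrite mulr_natl.
rewrite cos_mulr2n sin_mulr2n saE; split; first by rewrite -mulr_natr c2E; ring.
by rewrite -mulr_natr -xT -c2E; ring.
Qed.

(** Arcsine on [-1, 1], by the half-angle tangent. Since [Num.sqrt] is 0 on negative numbers, the
    formula is continuous and bounded on the whole line, as [continuous_perspective] requires. *)
Definition half_ang (z : R) : R := 2 * atan (z / (1 + Num.sqrt (1 - z ^+ 2))).

Lemma half_ang_sin (a : R) : - (pi / 2) <= a <= pi / 2 -> half_ang (sin a) = a.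
Proof.
move=> ha; have c0 := cos_ge0_pihalf ha; have p0 := pi_gt0 R.
rewrite /half_ang -cos2sin2 sqrtr_sqr ger0_norm //.
have [h1 h2] : -(pi/2) < a / 2 /\ a / 2 < pi / 2 by split; lra.
have ch0 : 0 < cos (a / 2) by apply: cos_gt0_pihalf; apply/andP; split.
have aE : a = (a / 2) *+ 2 by rewrite -mulr_natr divfK.
rewrite [in sin a]aE [in cos a]aE sin_mulr2n cos_mulr2n.
have -> : (cos (a / 2) * sin (a / 2)) *+ 2 /
    (1 + (cos (a / 2) ^+ 2 *+ 2 - 1)) = tan (a / 2).
  rewrite /tan; move: (cos (a / 2)) (sin (a / 2)) ch0 => c s c0'.
  have cn0 : c != 0 by rewrite gt_eqF.
  rewrite (_ : 1 + (c ^+ 2 *+ 2 - 1) = 2 * c ^+ 2); last by ring.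
  by field.
rewrite tanK ?in_itv /= ?h1 //; lra.
Qed.

Lemma half_ang0 : half_ang 0 = 0.
Proof. by rewrite /half_ang mul0r atan0 mulr0. Qed.

Lemma half_ang_bound (z : R) : `|half_ang z| <= pi.
Proof.
rewrite /half_ang normrM ger0_norm //.
have := atan_gtNpi2 (z / (1 + Num.sqrt (1 - z ^+ 2))).
have := atan_ltpi2 (z / (1 + Num.sqrt (1 - z ^+ 2))) => h1 h2.
suff : `|atan (z / (1 + Num.sqrt (1 - z ^+ 2)))| <= pi / 2 by lra.
by rewrite ler_norml; apply/andP; split; lra.
Qed.

Lemma half_ang_continuous : continuous half_ang.
Proof.
apply: cts_mul; first exact: cts_cst.
apply: (cts_comp (h := @atan R)); last by move=> t; exact: continuous_atan.
apply: cts_mul; first by move=> x; exact: cvg_id.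
apply: cts_inv => [|x]; last by rewrite gt_eqF // ltr_wpDr // sqrtr_ge0.
apply: cts_add; first exact: cts_cst.
apply: (cts_comp (h := @Num.sqrt R)); last exact: sqrt_continuous.
by apply: cts_sub; [exact: cts_cst|exact: exprn_continuous].
Qed.

(* F f(G / F) tends to 0 where F vanishes, whatever the junk value of G / 0. *)
Lemma continuous_perspective (T : topologicalType) (F G : T -> R) (f : R -> R)
    (C : R) : continuous F -> continuous G -> continuous f ->
  (forall z, `|f z| <= C) -> continuous (fun x => F x * f (G x / F x)).
Proof.
move=> Fc Gc fc fC x.
have [F0|F0] := eqVneq (F x) 0; last first.
  apply: cvgM; first exact: Fc.
  apply: (@continuous_comp _ _ _ (fun x => G x / F x) f); last exact: fc.
  by apply: cvgM; [exact: Gc|apply: cvgV => //; exact: Fc].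
rewrite /continuous_at F0 mul0r; apply/cvgr0Pnorm_le => e e0.
have C0 : 0 <= C by exact: le_trans (fC 0).
have eC : 0 < e / (C + 1) by rewrite divr_gt0 // ltr_wpDl.
have := Fc x; rewrite /continuous_at F0 => /cvgr0Pnorm_le /(_ _ eC).
apply: filterS => y Fy; rewrite normrM.
apply: (@le_trans _ _ (e / (C + 1) * (C + 1))); last by rewrite divfK // gt_eqF // ltr_wpDl.
by apply: ler_pM => //; apply: (le_trans (fC _)); rewrite lerDl.
Qed.

End RealFunctions.

(** * Plane vectors, winding and polar coordinates *)

Section PlaneGeometry.
Variable R : realType.
Implicit Types p q : plane R.

Definition cross p q : R := p.1 * q.2 - p.2 * q.1.
Definition dot p q : R := p.1 * q.1 + p.2 * q.2.
Definition modulus q : R := Num.sqrt (q.1 ^+ 2 + q.2 ^+ 2).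

Local Notation e := (@circle_point R).

Lemma modulus_ge0 q : 0 <= modulus q. Proof. exact: sqrtr_ge0. Qed.

Lemma modulus_sqr q : modulus q ^+ 2 = q.1 ^+ 2 + q.2 ^+ 2.
Proof. by rewrite sqr_sqrtr // addr_ge0 // sqr_ge0. Qed.

Lemma modulusZ (r t : R) : 0 <= r -> modulus (r *: e t) = r.
Proof.
move=> r0; rewrite /modulus /= -[RHS]ger0_norm // -sqrtr_sqr; congr Num.sqrt.
rewrite !exprMn -mulrDr cos2Dsin2 mulr1 //.
Qed.

Lemma modulus_le q (r : R) : 0 <= r ->
  (modulus q <= r) = (q.1 ^+ 2 + q.2 ^+ 2 <= r ^+ 2).
Proof.
by move=> r0; rewrite -modulus_sqr ler_pXn2r // nnegrE // modulus_ge0.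
Qed.

Lemma modulus_lt q (r : R) : 0 <= r ->
  (modulus q < r) = (q.1 ^+ 2 + q.2 ^+ 2 < r ^+ 2).
Proof.
by move=> r0; rewrite -modulus_sqr ltr_pXn2r // nnegrE // modulus_ge0.
Qed.

Lemma continuous_fst : continuous (fun q => q.1).
Proof. by move=> q; exact: cvg_fst. Qed.

Lemma continuous_snd : continuous (fun q => q.2).
Proof. by move=> q; exact: cvg_snd. Qed.

Lemma modulus_continuous : continuous modulus.
Proof.
apply: (cts_comp (h := @Num.sqrt R)); last exact: sqrt_continuous.
by apply: cts_add; apply: cts_exp; [exact: continuous_fst|exact: continuous_snd].
Qed.

Lemma circle_pointD2pi (t : R) : e (t + 2 * pi) = e t.
Proof.
have -> : 2 * pi = pi *+ 2 :> R by rewrite mulr_natl.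
by rewrite /circle_point cosD2pi sinD2pi.
Qed.

(* theta is t + mu1 - mu0 plus the deviation of the curve from that direction,
   which stays in (-pi, pi). *)
Lemma winds_onceP (h : plane R -> plane R) p (r mu0 mu1 : R) :
  continuous (fun t => (h (p + r *: e t)).1) ->
  continuous (fun t => (h (p + r *: e t)).2) ->
  (forall t, sin (t - mu0) != 0 ->
     0 < cross (e mu1) (h (p + r *: e t) - h p) * sin (t - mu0)) ->
  (forall t, sin (t - mu0) = 0 ->
     0 < dot (e mu1) (h (p + r *: e t) - h p) * cos (t - mu0)) ->
  winds_once h p r.
Proof.
move=> h1c h2c crossP dotP.
pose g t : plane R := h (p + r *: e t) - h p.
have g1c : continuous (fun t => (g t).1) by apply: cts_sub => //; exact: cts_cst.
have g2c : continuous (fun t => (g t).2) by apply: cts_sub => //; exact: cts_cst.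
pose tau t : R := t + (mu1 - mu0).
(* Coordinates of the curve in the frame that turns with [tau t]; the deviation is the argument of
   (X, Y). *)
pose X t := dot (e (tau t)) (g t); pose Y t := cross (e (tau t)) (g t).
have tau_c : continuous tau.
  by apply: cts_add; [move=> t; exact: cvg_id|exact: cts_cst].
have ct_c : continuous (fun t => cos (tau t)).
  by apply: (cts_comp (h := @cos R)) => //; exact: continuous_cos.
have st_c : continuous (fun t => sin (tau t)).
  by apply: (cts_comp (h := @sin R)) => //; exact: continuous_sin.
have X_c : continuous X by apply: cts_add; exact: cts_mul.
have Y_c : continuous Y by apply: cts_sub; exact: cts_mul.
have cs t := cos2Dsin2 (tau t).
have gE1 t : (g t).1 = X t * cos (tau t) - Y t * sin (tau t).
  by rewrite -[LHS]mulr1 -(cs t) /X /Y /dot /cross /=; ring.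
have gE2 t : (g t).2 = X t * sin (tau t) + Y t * cos (tau t).
  by rewrite -[LHS]mulr1 -(cs t) /X /Y /dot /cross /=; ring.
pose M t := modulus (X t, Y t).
have M_c : continuous M.
  apply: (cts_comp (h := @Num.sqrt R)); last exact: sqrt_continuous.
  by apply: cts_add; exact: cts_exp.
have M0 t : 0 <= M t := modulus_ge0 _.
have Msq t : M t ^+ 2 = X t ^+ 2 + Y t ^+ 2 := modulus_sqr _.
have crossE t : cross (e mu1) (g t) = X t * sin (t - mu0) + Y t * cos (t - mu0).
  have -> : t - mu0 = tau t - mu1 by rewrite /tau; ring.
  by rewrite sinB cosB /cross gE1 gE2 /=; ring.
have dotE t : dot (e mu1) (g t) = X t * cos (t - mu0) - Y t * sin (t - mu0).
  have -> : t - mu0 = tau t - mu1 by rewrite /tau; ring.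
  by rewrite sinB cosB /dot gE1 gE2 /=; ring.
(* Otherwise (X, Y) lies on the closed negative half-axis. Then Y = 0, and the products in [crossP]
   and [dotP] become X times a square, hence nonpositive. *)
have MX t : 0 < M t + X t.
  rewrite ltNge; apply/negP => MX0.
  have XM : X t <= - M t by lra.
  have Y0 : Y t = 0.
    apply/eqP; rewrite -sqrf_eq0 eq_le sqr_ge0 andbT.
    by have := Msq t; have := M0 t; nra.
  have X0 : X t <= 0 by have := M0 t; lra.
  have [s0|s0] := eqVneq (sin (t - mu0)) 0.
    have := dotP _ s0; rewrite -/(g t) dotE Y0 s0; nra.
  have := crossP _ s0; rewrite -/(g t) crossE Y0; nra.
have Mgt0 t : 0 < M t.
  rewrite lt_neqAle M0 andbT eq_sym; apply/eqP => MtE.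
  have := MX t; rewrite MtE add0r => X0.
  by have := Msq t; rewrite MtE; nra.
have per t : g (t + 2 * pi) = g t by rewrite /g circle_pointD2pi.
have tau2 t : tau (t + 2 * pi) = tau t + 2 * pi by rewrite /tau; ring.
have X2 t : X (t + 2 * pi) = X t by rewrite /X per tau2 circle_pointD2pi.
have Y2 t : Y (t + 2 * pi) = Y t by rewrite /Y per tau2 circle_pointD2pi.
exists (fun t => tau t + 2 * atan (Y t / (M t + X t))), M; split => //.
- apply: cts_add => //; apply: cts_mul; first exact: cts_cst.
  apply: (cts_comp (h := @atan R)); last by move=> t; exact: continuous_atan.
  apply: cts_mul => //; apply: cts_inv => [|t]; last by rewrite gt_eqF.
  exact: cts_add.
- by move=> t; rewrite /M X2 Y2 tau2; ring.
- move=> t.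
  have Mn0 : M t != 0 by rewrite gt_eqF.
  have MXn0 : M t + X t != 0 by rewrite gt_eqF.
  have xy : (X t / M t) ^+ 2 + (Y t / M t) ^+ 2 = 1.
    by rewrite !expr_div_n -mulrDl -Msq divff // sqrf_eq0.
  have x1 : -1 < X t / M t.
    by rewrite ltr_pdivlMr //; have := MX t; lra.
  have := half_angle xy x1.
  have -> : Y t / M t / (1 + X t / M t) = Y t / (M t + X t).
    by field; rewrite MXn0 Mn0.
  case=> cE sE.
  have hE : h (p + r *: e t) = h p + g t by rewrite /g addrCA subrr addr0.
  rewrite hE; congr (_ + _).
  rewrite [g t]surjective_pairing gE1 gE2 /circle_point cosD sinD cE sE.
  congr pair; rewrite /= /GRing.scale /=; field => //.
Qed.

Lemma polar_coordinates q : exists r t : R,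
  [/\ 0 <= r, 0 <= t < 2 * pi & q = r *: e t].
Proof.
have p0 := pi_gt0 R.
pose M := modulus q; have Msq : M ^+ 2 = q.1 ^+ 2 + q.2 ^+ 2 := modulus_sqr _.
have [M0|M0] := eqVneq M 0.
  exists 0, 0; split; rewrite ?lexx //=; first by lra.
  have [] : q.1 = 0 /\ q.2 = 0.
    move: Msq; rewrite M0 expr0n /= => /esym/eqP.
    by rewrite paddr_eq0 ?sqr_ge0 // !sqrf_eq0 => /andP[/eqP-> /eqP->].
  by case: q {M Msq M0} => a b /= -> ->; rewrite scale0r.
have Mgt0 : 0 < M by rewrite lt_neqAle eq_sym M0 modulus_ge0.
suff [t [ht1 ht2 hc hs]] : exists t : R, [/\ - pi < t, t <= pi,
    cos t = q.1 / M & sin t = q.2 / M].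
  have qE : q = M *: e t.
    by rewrite [q]surjective_pairing /circle_point hc hs; congr pair;
      rewrite /= /GRing.scale /= mulrC divfK.
  have [t0|t0] := leP 0 t.
    by exists M, t; split; rewrite ?modulus_ge0 // t0 /=; lra.
  exists M, (t + 2 * pi); split; rewrite ?modulus_ge0 ?circle_pointD2pi //.
  by apply/andP; split; lra.
have xy : (q.1 / M) ^+ 2 + (q.2 / M) ^+ 2 = 1.
  by rewrite !expr_div_n -mulrDl -Msq divff // sqrf_eq0.
(* [half_angle] misses only the point (-1, 0) of the circle, whose angle is pi. *)
have [x1|x1] := ltP (-1) (q.1 / M).
  have [hc hs] := half_angle xy x1.
  exists (2 * atan (q.2 / M / (1 + q.1 / M))); split => //.
    by have := atan_gtNpi2 (q.2 / M / (1 + q.1 / M)); lra.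
  by have := atan_ltpi2 (q.2 / M / (1 + q.1 / M)); lra.
have y0 : q.2 / M = 0.
  apply/eqP; rewrite -sqrf_eq0 eq_le sqr_ge0 andbT; nra.
exists pi; rewrite cospi sinpi y0; split => //; first by lra.
by move: xy; rewrite y0 => xy; nra.
Qed.

End PlaneGeometry.

(** * Coordinates on the k equal sectors of the plane *)

Section Sectors.
Variables (R : realType) (k : nat).
Hypothesis k_gt4 : (4 < k)%N.
Implicit Types (q : plane R) (a b t r : R).

Local Notation e := (@circle_point R).

Definition sector_angle : R := 2 * pi / k%:R.
Local Notation th := sector_angle.

Definition ray (x : R) : plane R := e (th * x).

Lemma k_gt0 : 0 < k%:R :> R. Proof. by rewrite ltr0n; lia. Qed.

Lemma sector_angleM : th * k%:R = 2 * pi.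
Proof. by rewrite /th divfK // gt_eqF // k_gt0. Qed.

Lemma sector_angle_gt0 : 0 < th.
Proof. by rewrite divr_gt0 ?k_gt0 // mulr_gt0 // pi_gt0. Qed.

(** From k > 4: sectors narrower than a quarter turn make [cos th] positive as well as [sin th],
    which settles the signs in [hat_sector_shift]. *)
Lemma sector_angle_lt : th < pi / 2.
Proof.
have k5 : 5 <= k%:R :> R by rewrite ler_nat.
by have := sector_angleM; have := sector_angle_gt0; have := pi_gt0 R; nra.
Qed.

Lemma sin_sector_gt0 : 0 < sin th.
Proof. by apply: sin_gt0_pihalf; rewrite sector_angle_gt0 sector_angle_lt. Qed.

Lemma cos_sector_gt0 : 0 < cos th.
Proof.
apply: cos_gt0_pihalf; rewrite sector_angle_lt andbT.
by have := sector_angle_gt0; have := pi_gt0 R; lra.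
Qed.

Lemma rayDk (x : R) : ray (x + k%:R) = ray x.
Proof. by rewrite /ray mulrDr sector_angleM circle_pointD2pi. Qed.

Lemma cross_circle_point (s t : R) : cross (e s) (e t) = sin (t - s).
Proof. by rewrite /cross sinB /=; ring. Qed.

Lemma crossDl p q q' : cross (p + q) q' = cross p q' + cross q q'.
Proof. by rewrite /cross /=; ring. Qed.

Lemma crossZl a p q : cross (a *: p) q = a * cross p q.
Proof. by rewrite /cross /= /GRing.scale /=; ring. Qed.

Lemma crossC p q : cross p q = - cross q p.
Proof. by rewrite /cross; ring. Qed.

Lemma cross_ray (x y : R) : cross (ray x) (ray y) = sin (th * (y - x)).
Proof. by rewrite cross_circle_point mulrBr. Qed.

(* On the sector spanned by two consecutive rays, the coordinate along the ray
   x; the minimum of the two cross products is nonpositive outside the two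
   sectors adjacent to that ray. *)
Definition hat (x : R) q : R :=
  Num.max 0 (Num.min (cross q (ray (x + 1))) (cross (ray (x - 1)) q)) / sin th.

Lemma hat_continuous (x : R) : continuous (hat x).
Proof.
apply: cts_mul; last exact: cts_cst.
apply: cts_max; first exact: cts_cst.
have c1 := @continuous_fst R; have c2 := @continuous_snd R.
by apply: cts_min; apply: cts_sub; apply: cts_mul => //; exact: cts_cst.
Qed.

Lemma hatDk (x : R) q : hat (x + k%:R) q = hat x q.
Proof. by rewrite /hat addrAC rayDk -(addrAC x) rayDk. Qed.

Lemma sin_sectorDk (x : R) : sin (th * (x + k%:R)) = sin (th * x).
Proof. by have /(congr1 snd) := rayDk x. Qed.

(** For d at least 2, one of the two cross products in [hat] is nonpositive: the one with the
    preceding ray if d - 1 sectors fit in half a turn, the one with the following ray otherwise. *)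
Lemma hat_sector_shift (i d : nat) a b : (d < k)%N -> 0 <= a -> 0 <= b ->
  hat (i + d)%:R (a *: ray i%:R + b *: ray (i%:R + 1)) =
  if d == 0 then a else if d == 1 then b else 0.
Proof.
move=> dk a0 b0; have s0 := sin_sector_gt0; have c0 := cos_sector_gt0.
have th0 := sector_angle_gt0; have thk := sector_angleM.
rewrite /hat (crossC (ray (_ - 1))) !crossDl !crossZl !cross_ray natrD.
rewrite (_ : i%:R + d%:R + 1 - i%:R = d%:R + 1); last by ring.
rewrite (_ : i%:R + d%:R + 1 - (i%:R + 1) = d%:R); last by ring.
rewrite (_ : i%:R + d%:R - 1 - i%:R = d%:R - 1); last by ring.
rewrite (_ : i%:R + d%:R - 1 - (i%:R + 1) = d%:R - 2); last by ring.
have s2 : sin (th * 2) = 2 * (cos th * sin th) by rewrite mulr_natr sin_mulr2n mulr_natl.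
have as0 : 0 <= a * sin th by rewrite mulr_ge0 // ltW.
have bs0 : 0 <= b * sin th by rewrite mulr_ge0 // ltW.
have acs0 : 0 <= a * sin th * cos th by rewrite mulr_ge0 // ltW.
have bcs0 : 0 <= b * sin th * cos th by rewrite mulr_ge0 // ltW.
have [->|d0] := eqVneq d 0%N.
  rewrite add0r !sub0r mulr0 sin0 !mulrN !mulr1 !sinN s2.
  rewrite min_l ?mulr0 ?addr0; last by nra.
  by rewrite max_r ?mulfK ?gt_eqF //; nra.
have [->|d1] := eqVneq d 1%N.
  rewrite subrr mulr0 sin0 mulr0 add0r (_ : 1%:R - 2 = -1 :> R); last by ring.
  rewrite mulrN1 sinN mulr1 (_ : 1%:R + 1 = 2 :> R) // s2.
  rewrite min_r; last by nra.
  by rewrite mulrN opprK max_r ?mulfK ?gt_eqF //; nra.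
rewrite max_l ?mul0r // ge_min.
have d2 : 2 <= d%:R :> R by rewrite ler_nat; lia.
have dk' : d%:R + 1 <= k%:R :> R by rewrite natr1 ler_nat.
have [h|h] := leP (th * (d%:R - 1)) pi.
  apply/orP; right; rewrite oppr_le0.
  by apply: addr_ge0; apply: mulr_ge0 => //; apply: sin_ge0_pi; nra.
have sin_le0 x : pi <= th * x -> x <= k%:R -> sin (th * x) <= 0.
  move=> x1 x2; rewrite -sin_sectorDk -oppr_ge0 -sinDpi.
  have -> : th * (x + k%:R) + pi = (th * x - pi) + pi *+ 2 + pi *+ 2.
    by rewrite mulrDr thk; ring.
  by rewrite !sinD2pi; apply: sin_ge0_pi; nra.
apply/orP; left.
have h1 := sin_le0 (d%:R + 1); have h2 := sin_le0 d%:R.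
have : sin (th * (d%:R + 1)) <= 0 by apply: h1; nra.
have : sin (th * d%:R) <= 0 by apply: h2; nra.
by nra.
Qed.

(* f is k-periodic, so that the index i + 1 is meant modulo k. *)
Lemma sum_hat (f : nat -> R) (g : R -> R) (i : nat) a b :
  (forall j, f (j + k)%N = f j) -> g 0 = 0 -> 0 <= a -> 0 <= b ->
  \sum_(j < k) f j * g (hat j%:R (a *: ray i%:R + b *: ray (i%:R + 1))) =
  f i * g a + f i.+1 * g b.
Proof.
move=> fk g0 a0 b0; set q := _ + _; pose F j := f j * g (hat j%:R q).
have Fk j : F (j + k)%N = F j by rewrite /F fk natrD hatDk.
have FE d : (d < k)%N -> F (i + d)%N =
    f (i + d)%N * g (if d == 0%N then a else if d == 1%N then b else 0).
  by move=> dk; rewrite /F hat_sector_shift.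
(* A sum over a full period may start anywhere; started at i, only its first two terms survive. *)
have shift : forall n, \sum_(j < k) F (n + j)%N = \sum_(j < k) F j.
  elim=> // n <-; rewrite -!(big_mkord xpredT (fun j => F (_ + j)%N)).
  case: k k_gt4 Fk => // k' _ Fk'.
  rewrite big_nat_recr //= big_nat_recl //= addn0 addrC -(Fk' n).
  congr (_ + _); first by rewrite addSnnS.
  by apply: eq_bigr => j _; rewrite addSnnS.
rewrite -(shift i) -(big_mkord xpredT (fun j => F (i + j)%N)).
rewrite big_ltn; last by lia.
rewrite big_ltn; last by lia.
rewrite big_nat_cond big1 => [|j /andP[/andP[j1 j2] _]]; last first.
  by rewrite FE //; case: j j1 j2 => [|[|j]] //; rewrite g0 mulr0.
by rewrite addr0 !FE ?addn0 ?addn1 //; lia.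
Qed.

(** The law of sines: decomposition of a unit vector along two directions making the angles B and A
    with it. *)
Lemma sector_interpolation (A B s : R) :
  sin (A + B) *: e (s + B) = sin A *: e s + sin B *: e (s + A + B).
Proof.
rewrite /circle_point; congr pair; rewrite /= /GRing.scale /=.
  rewrite !cosD !sinD; have := cos2Dsin2 B; have := cos2Dsin2 A.
  move: (cos A) (sin A) (cos B) (sin B) (cos s) (sin s) => cA sA cB sB cs ss h1 h2.
  rewrite -[in RHS](mulr1 (sA * cs)) -h2; ring.
rewrite !sinD !cosD; have := cos2Dsin2 B; have := cos2Dsin2 A.
move: (cos A) (sin A) (cos B) (sin B) (cos s) (sin s) => cA sA cB sB cs ss h1 h2.
rewrite -[in RHS](mulr1 (sA * ss)) -h2; ring.
Qed.

Lemma ray_interpolation (x t : R) : ray (x + t) =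
  (sin (th * (1 - t)) / sin th) *: ray x + (sin (th * t) / sin th) *: ray (x + 1).
Proof.
have sn0 : sin th != 0 by rewrite gt_eqF // sin_sector_gt0.
apply: (scalerI sn0); rewrite scalerDr !scalerA !(mulrC (sin th)) !divfK //.
have := sector_interpolation (th * (1 - t)) (th * t) (th * x).
rewrite -mulrDr -mulrDr addrNK mulr1 /ray => ->.
by congr (_ + _ *: e _); ring.
Qed.

Lemma sectorP q : exists (r t : R) (i : nat),
  [/\ 0 <= r, 0 <= t <= 1 & q = r *: ray (i%:R + t)].
Proof.
have th0 := sector_angle_gt0.
have [r [s [r0 /andP[s0 s1] ->]]] := polar_coordinates q.
have sth : 0 <= s / th by rewrite divr_ge0 // ltW.
have /andP[h1 h2] := truncn_itv sth.
exists r, (s / th - (Num.truncn (s / th))%:R), (Num.truncn (s / th)); split => //.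
  by move: h2; rewrite -natr1 => h2; apply/andP; split; lra.
by rewrite addrC subrK /ray mulrC divfK // gt_eqF.
Qed.

Lemma sin_sector_part t : 0 <= t <= 1 -> 0 <= sin (th * t).
Proof.
move=> /andP[t0 t1]; apply: sin_ge0_pi.
by have := sector_angle_gt0; have := sector_angle_lt; have := pi_gt0 R; nra.
Qed.

Lemma coneP q : exists (a b : R) (i : nat),
  [/\ 0 <= a, 0 <= b & q = a *: ray i%:R + b *: ray (i%:R + 1)].
Proof.
have [r [t [i [r0 /andP[t0 t1] ->]]]] := sectorP q; have s0 := sin_sector_gt0.
exists (r * (sin (th * (1 - t)) / sin th)), (r * (sin (th * t) / sin th)), i.
split; last by rewrite ray_interpolation scalerDr !scalerA.
  by rewrite mulr_ge0 ?divr_ge0 ?(ltW s0) // sin_sector_part //; lra.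
by rewrite mulr_ge0 ?divr_ge0 ?(ltW s0) // sin_sector_part //; lra.
Qed.

(* The analogue of hat for which the circle, not the polygon, is the locus
   where the coordinates add up to 1. *)
Definition polar_hat (x : R) q : R :=
  modulus q * half_ang (sin th * hat x q / modulus q) / th.

Lemma polar_hat_continuous (x : R) : continuous (polar_hat x).
Proof.
apply: cts_mul; last exact: cts_cst.
apply: (continuous_perspective (C := pi)).
- exact: modulus_continuous.
- by apply: cts_mul; [exact: cts_cst|exact: hat_continuous].
- exact: half_ang_continuous.
- exact: half_ang_bound.
Qed.

(** By [ray_interpolation], [sin th * hat / modulus] is on this sector the sine of the angle to the
    opposite bounding ray. Its arcsine is affine in t, which gives the constant speed that
    [bounded_by] asks for. *)
Lemma polar_sum (f : nat -> R) (i : nat) r t :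
  (forall j, f (j + k)%N = f j) -> 0 <= r -> 0 <= t <= 1 ->
  \sum_(j < k) f j * polar_hat j%:R (r *: ray (i%:R + t)) =
  f i * (r * (1 - t)) + f i.+1 * (r * t).
Proof.
move=> fk r0 /andP[t0 t1]; have s0 := sin_sector_gt0.
have sn0 : sin th != 0 by rewrite gt_eqF.
have thn0 : th != 0 by rewrite gt_eqF // sector_angle_gt0.
have Mr : modulus (r *: ray (i%:R + t)) = r by exact: modulusZ.
have [->|rn0] := eqVneq r 0.
  rewrite scale0r !mul0r !mulr0 addr0 big1 // => j _.
  by rewrite /polar_hat /modulus !expr0n /= addr0 sqrtr0 !mul0r mulr0.
rewrite /polar_hat Mr ray_interpolation scalerDr !scalerA.
rewrite (sum_hat (g := fun x => r * half_ang (sin th * x / r) / th)) //; last first.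
- by rewrite mulr_ge0 ?divr_ge0 ?(ltW s0) // sin_sector_part //; lra.
- by rewrite mulr_ge0 ?divr_ge0 ?(ltW s0) // sin_sector_part //; lra.
- by rewrite mulr0 mul0r half_ang0 mulr0 mul0r.
have E y : sin th * (r * (y / sin th)) / r = y by field; rewrite rn0 sn0.
have th0 := sector_angle_gt0; have thlt := sector_angle_lt; have p0 := pi_gt0 R.
rewrite !E !half_ang_sin; first by congr (_ + _); field.
- by apply/andP; split; nra.
- by apply/andP; split; nra.
Qed.

(** Recovers the point from its two coordinates r (1 - t) and r t and from their sum r. The
    quotients by r are left unsimplified to match [disc_inv]. *)
Lemma ray_polar (i : nat) r t : 0 <= r -> 0 <= t <= 1 ->
  (r * sin (th * (r * (1 - t)) / r) / sin th) *: ray i%:R +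
  (r * sin (th * (r * t) / r) / sin th) *: ray (i%:R + 1) =
  r *: ray (i%:R + t).
Proof.
move=> r0 t01; have [->|rn0] := eqVneq r 0.
  by rewrite !mul0r !scale0r addr0.
have E y : th * (r * y) / r = th * y by field.
by rewrite !E (ray_interpolation _ t) scalerDr !scalerA !mulrA.
Qed.

End Sectors.

(** * Realization of a triangulated surface *)

Section FunctionSpace.
Variables (R : realType) (W : choiceType).

Lemma cvg_ptws (F : set_system (W -> R)) (f : W -> R) : Filter F ->
  (forall z, g z @[g --> F] --> f z) -> F --> (f : {ptws W -> R}).
Proof.
move=> FF Ff; apply/cvg_sup => z; rewrite cvg_image; last first.
  by rewrite eqEsubset; split=> v // _; exists (cst v).
move=> A /Ff FA; exists (@^~ z @^-1` A) => //.
by rewrite eqEsubset; split => [_ [? + <-]//|j Aj]; exists (fun _ => j).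
Qed.

Lemma ptws_eval_continuous (z : W) :
  continuous (fun x : {ptws W -> R} => x z).
Proof. exact: (@proj_continuous W (fun=> R) z). Qed.

Section Subspace.
Variable A : set {ptws W -> R}.

Definition coord (z : W) (x : set_type A) : R := \val x z.

Lemma coord_continuous z : continuous (coord z).
Proof.
move=> x; apply: (@continuous_comp _ _ _ (fun x : set_type A => \val x)
  (fun x : {ptws W -> R} => x z)); last exact: ptws_eval_continuous.
exact: (@initial_continuous (set_type A) _ (fun x : set_type A => \val x)).
Qed.

Lemma set_type_hausdorff : hausdorff_space (set_type A).
Proof.
rewrite open_hausdorff => x y xy.
have [z xyz] : exists z, coord z x != coord z y.
  apply: contrapT => /forallNP all_eq; move/negP: xy; apply; apply/eqP/val_inj/funext => z.
  by apply: contra_notP (all_eq z) => /eqP.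
have := @norm_hausdorff R R; rewrite open_hausdorff => /(_ _ _ xyz).
move=> [[U V] /= [xU yV] [Uo Vo /eqP UV0]].
exists (coord z @^-1` U, coord z @^-1` V) => /=; first by split; rewrite inE /=; exact/set_mem.
split; [apply: open_comp => // ? _; exact: coord_continuous..|].
by rewrite -preimage_setI UV0 preimage_set0.
Qed.

Variable x0 : set_type A.

Definition to_subspace (x : W -> R) : set_type A :=
  if pselect (A x) is left Ax then exist _ x (mem_set Ax) else x0.

Lemma to_subspaceK (x : W -> R) : A x -> \val (to_subspace x) = x.
Proof. by rewrite /to_subspace; case: pselect. Qed.

Lemma valK_subspace (x : set_type A) : to_subspace (\val x) = x.
Proof. by apply/val_inj/to_subspaceK/set_mem/valP. Qed.

(** The maps into the surface (inverse charts, discs, the graph) are all given by their coordinates,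
    so their continuity reduces to that of real functions. *)
Lemma to_subspace_continuous (T : topologicalType) (B : set T)
    (f : T -> W -> R) : (forall t, B t -> A (f t)) ->
  (forall z, continuous (fun t => f t z)) ->
  {within B, continuous (fun t => to_subspace (f t))}.
Proof.
move=> BA fc; apply/subspace_continuousP => t Bt U [_ [[V Vo <-] /= Vt] VU].
have nV : nbhs (f t : {ptws W -> R}) V.
  by apply: open_nbhs_nbhs; split => //; rewrite -(to_subspaceK (BA _ Bt)).
have ft : f s @[s --> t] --> (f t : {ptws W -> R}).
  by apply: cvg_ptws => z; exact: fc.
have {}ft : nbhs t (f @^-1` V) by exact: ft.
rewrite /= /within /=; apply: filterS ft => s Vs Bs.
apply: VU; have : V (f s) by exact: Vs.
by rewrite -{1}(to_subspaceK (BA _ Bs)).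
Qed.

End Subspace.
End FunctionSpace.

(** * Cross and dot products against unit vectors *)

Section CrossDot.
Variable R : realType.
Implicit Types p q u : plane R.
Local Notation e := (@circle_point R).

Lemma crossB u p q : cross u (p - q) = cross u p - cross u q.
Proof. by rewrite /cross /=; ring. Qed.

Lemma dotB u p q : dot u (p - q) = dot u p - dot u q.
Proof. by rewrite /dot /=; ring. Qed.

Lemma cross_comb3 (m a b d s1 s2 s3 : R) :
  cross (e m) (a *: e s1 + b *: e s2 + d *: e s3) =
  a * sin (s1 - m) + b * sin (s2 - m) + d * sin (s3 - m).
Proof. by rewrite /cross /= /GRing.scale /= !sinB; ring. Qed.

Lemma dot_comb3 (m a b d s1 s2 s3 : R) :
  dot (e m) (a *: e s1 + b *: e s2 + d *: e s3) =
  a * cos (s1 - m) + b * cos (s2 - m) + d * cos (s3 - m).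
Proof. by rewrite /dot /= /GRing.scale /= !cosB; ring. Qed.

Lemma cross_circleZ (m r t : R) : cross (e m) (r *: e t) = r * sin (t - m).
Proof. by rewrite /cross /= /GRing.scale /= !sinB; ring. Qed.

Lemma dot_circleZ (m r t : R) : dot (e m) (r *: e t) = r * cos (t - m).
Proof. by rewrite /dot /= /GRing.scale /= !cosB; ring. Qed.

(** Here b and a are the positive and negative parts of b - a. In a kite they are the weights of the
    two opposite corners, at most one of which is nonzero. *)
Lemma disjoint_sub_inj (a b a' b' : R) :
  0 <= a -> 0 <= b -> 0 <= a' -> 0 <= b' -> a = 0 \/ b = 0 ->
  a' = 0 \/ b' = 0 -> b - a = b' - a' -> a = a' /\ b = b'.
Proof. by move=> ? ? ? ? [?|?] [?|?] ?; split; lra. Qed.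

End CrossDot.

(** * Discs of the plane *)

Section Discs.
Variable R : realType.
Implicit Types p q : plane R.
Local Notation e := (@circle_point R).
Local Notation disc := (closed_disc (origin R) 1).

Lemma discE q : disc q = (modulus q <= 1).
Proof. by rewrite /closed_disc /= !subr0 modulus_le. Qed.

Lemma open_discE q : open_disc (origin R) 1 q = (modulus q < 1).
Proof. by rewrite /open_disc /= !subr0 modulus_lt. Qed.

Lemma disc_compact : compact disc.
Proof.
apply: (@subclosed_compact _ _ (`[-1 : R, 1]%classic `*` `[-1 : R, 1]%classic)).
- rewrite (_ : disc = @modulus R @^-1` [set x | x <= 1]); last first.
    by apply/funext => q; rewrite discE.
  have /continuous_closedP := @modulus_continuous R; apply; exact: closed_le.
- by apply: compact_setX; exact: segment_compact.
move=> q; rewrite discE modulus_le // => q1.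
by split; rewrite /= in_itv /=; apply/andP; split; nra.
Qed.

Lemma segment_to_continuous q : continuous (fun s : R => s *: q).
Proof.
rewrite (_ : (fun _ => _) = fun s : R => (s * q.1, s * q.2)) // => s.
have lin_cts (a : R) : (fun s => s * a) @ s --> s * a.
  by apply: cvgM => //; exact: cvg_cst.
exact: (cvg_pair (lin_cts q.1) (lin_cts q.2)).
Qed.

Lemma star_shaped_connected (A : set (plane R)) :
  (forall q s, A q -> 0 <= s <= 1 -> A (s *: q)) -> connected A.
Proof.
move=> Astar; pose I q : set (plane R) := (fun s => s *: q) @` `[0, 1]%classic.
rewrite (_ : A = \bigcup_(q in A) I q); last first.
  apply/seteqP; split=> [q Aq|q [q' Aq' [s /=]]].
    by exists q => //; exists 1; rewrite ?scale1r //= in_itv /= lexx ler01.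
  by rewrite in_itv /= => s01 <-; exact: Astar.
apply: bigcup_connected.
  by exists 0 => q Aq; exists 0; rewrite ?scale0r //= in_itv /= lexx ler01.
move=> q Aq; apply: connected_continuous_connected.
  exact: segment_connected.
exact/continuous_subspaceT/segment_to_continuous.
Qed.

Lemma modulus_scale (s : R) q : 0 <= s -> modulus (s *: q) = s * modulus q.
Proof.
move=> s0; rewrite /modulus /= /GRing.scale /= !exprMn -mulrDr.
by rewrite sqrtrM ?sqr_ge0 // sqrtr_sqr ger0_norm.
Qed.

Lemma disc_connected : connected disc.
Proof.
apply: star_shaped_connected => q s; rewrite !discE => q1 /andP[s0 s1].
by rewrite modulus_scale //; have := modulus_ge0 q; nra.
Qed.

Lemma open_disc_connected : connected (open_disc (origin R) 1).
Proof.
apply: star_shaped_connected => q s; rewrite !open_discE => q1 /andP[s0 s1].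
by rewrite modulus_scale //; have := modulus_ge0 q; nra.
Qed.

Lemma open_closed_disc (U : set (plane R)) p : open U -> U p ->
  exists2 r : R, 0 < r & closed_disc p r `<=` U.
Proof.
move=> Uo Up; have /nbhs_ballP[eps /= eps0 epsU] := open_nbhs_nbhs (conj Uo Up).
exists (eps / 2); first by rewrite divr_gt0.
move=> q /= qp; apply: epsU; rewrite /ball /= /prod_ball /ball /=.
have s1 := sqr_ge0 (q.1 - p.1); have s2 := sqr_ge0 (q.2 - p.2).
rewrite /closed_disc /= in qp.
have small x : x ^+ 2 <= (eps / 2) ^+ 2 -> `|x| < eps.
  by move=> xe; rewrite ltr_norml; apply/andP; split; nra.
by split; rewrite distrC; apply: small; lra.
Qed.

End Discs.

(* The link of the vertex w is the cycle c w 0, c w 1, ... of length k w, in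
   counterclockwise order; indices are meant modulo k w. By c_tri a triangle
   (w, a, b) with b next to a around w is also found, with the same orientation,
   around a. *)
Section Complex.
Variables (R : realType) (W : finType) (k : W -> nat) (c : W -> nat -> W).
Hypothesis k_gt4 : forall w, (4 < k w)%N.
Hypothesis c_eq : forall w i j, (c w i == c w j) = (i == j %[mod k w]).
Hypothesis c_neq : forall w i, c w i != w.
Hypothesis c_tri : forall w i,
  exists l, c (c w i) l = c w i.+1 /\ c (c w i) l.+1 = w.
Implicit Types (w z : W) (i j : nat) (a b r t : R) (q : plane R).

Local Notation e := (@circle_point R).

Lemma c_mod w i j : i = j %[mod k w] -> c w i = c w j.
Proof. by move=> ij; apply/eqP; rewrite c_eq ij. Qed.

Lemma cDk w i : c w (i + k w)%N = c w i.
Proof. by apply: c_mod; rewrite modnDr. Qed.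

Lemma c_succ_neq w i : c w i.+1 != c w i.
Proof.
rewrite c_eq -addn1 -[X in _ == X %[mod _]]addn0 eqn_modDl.
by rewrite !modn_small //; have := k_gt4 w; lia.
Qed.

Definition simplex w i : seq W := [:: w; c w i; c w i.+1].

Lemma simplex_uniq w i : uniq (simplex w i).
Proof.
by rewrite /= !inE negb_or !(eq_sym w) !c_neq eq_sym c_succ_neq.
Qed.

(** One or two applications of [c_tri] turn a triangle so that it is seen from any of its
    corners. *)
Lemma simplex_rot w i z : z \in simplex w i ->
  exists j, perm_eq (simplex w i) (simplex z j).
Proof.
have rot1 u j : exists l, perm_eq (simplex u j) (simplex (c u j) l).
  have [l [h1 h2]] := c_tri u j; exists l.
  by rewrite /simplex h1 h2 perm_sym -(perm_rot 2).
rewrite !inE => /or3P[] /eqP->; first by exists i.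
  exact: rot1.
have [l [h1 h2]] := c_tri w i; have [l' h] := rot1 (c w i) l; exists l'.
rewrite h1 in h; apply: perm_trans h.
by rewrite /simplex h1 h2 perm_sym -(perm_rot 2).
Qed.

Definition points : set {ptws W -> R} :=
  [set x | [/\ forall z, 0 <= x z, \sum_z x z = 1 &
     exists w i, forall z, x z != 0 -> z \in simplex w i]].

Definition tri w i a b : W -> R := fun z =>
  (z == w)%:R * (1 - a - b) + (z == c w i)%:R * a + (z == c w i.+1)%:R * b.

Lemma tri_w w i a b : tri w i a b w = 1 - a - b.
Proof.
by rewrite /tri eqxx !(eq_sym w) !(negbTE (c_neq _ _)) mul1r !mul0r !addr0.
Qed.

Lemma sum_delta (z : W) a : \sum_y (y == z)%:R * a = a.
Proof.
rewrite (bigD1 z) //= eqxx mul1r big1 ?addr0 // => y /negbTE->.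
by rewrite mul0r.
Qed.

Lemma tri_points w i a b : 0 <= a -> 0 <= b -> a + b <= 1 ->
  points (tri w i a b).
Proof.
move=> a0 b0 ab; split.
- by move=> z; rewrite /tri; do ?apply: addr_ge0; apply: mulr_ge0 => //; lra.
- by rewrite !big_split /= !sum_delta; ring.
exists w, i => z; apply: contraNT; rewrite !inE !negb_or => /and3P[].
by rewrite /tri => /negbTE-> /negbTE-> /negbTE->; rewrite !mul0r !addr0.
Qed.

Lemma simplexP (x : W -> R) w i z : points x ->
  (forall y, x y != 0 -> y \in simplex w i) -> z \in simplex w i ->
  exists j a b, [/\ 0 <= a, 0 <= b, a + b <= 1 & x = tri z j a b].
Proof.
move=> [x0 x1 _] supp /simplex_rot[j wz].
have {supp wz} supp y : x y != 0 -> y \in simplex z j.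
  by move=> /supp; rewrite (perm_mem wz).
have := simplex_uniq z j; rewrite /= !inE negb_or => /andP[/andP[n1 n2] /andP[n3 _]].
have xE : \sum_y x y = x z + x (c z j) + x (c z j.+1).
  rewrite (bigD1 z) //= (bigD1 (c z j)) ?c_neq //= (bigD1 (c z j.+1)) /=; last first.
    by rewrite c_neq c_succ_neq.
  rewrite big1 ?addr0 ?addrA // => y /andP[/andP[y1 y2] y3].
  apply/eqP; apply: contraTT isT => /supp.
  by rewrite !inE (negbTE y1) (negbTE y2) (negbTE y3).
have p1 := x0 (c z j); have p2 := x0 (c z j.+1); have p3 := x0 z.
exists j, (x (c z j)), (x (c z j.+1)); split => //; first by lra.
apply/funext => y; rewrite /tri.
have -> : 1 - x (c z j) - x (c z j.+1) = x z by lra.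
have [->|yz] := eqVneq y z; first by rewrite (negbTE n1) (negbTE n2) mul1r !mul0r !addr0.
have [->|y1] := eqVneq y (c z j); first by rewrite (negbTE n3) mul1r !mul0r add0r addr0.
have [->|y2] := eqVneq y (c z j.+1); first by rewrite mul1r !mul0r !add0r.
rewrite !mul0r !addr0; apply/eqP; apply: contraTT isT => /supp.
by rewrite !inE (negbTE yz) (negbTE y1) (negbTE y2).
Qed.

Lemma starP (x : W -> R) w : points x -> 0 < x w ->
  exists i a b, [/\ 0 <= a, 0 <= b, a + b < 1 & x = tri w i a b].
Proof.
move=> px xw; have [x0 x1 [w' [i' supp]]] := px.
have /supp ww : x w != 0 by rewrite gt_eqF.
have [i [a [b [a0 b0 ab xE]]]] := simplexP px supp ww.
exists i, a, b; split => //.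
by move: xw; rewrite xE tri_w; lra.
Qed.

Local Notation hatw w i := (hat (k w) (i%:R : R)).
Local Notation rayw w := (@ray R (k w)).

(** Inverse of [star_map], written as one sum of hats rather than sector by sector, so that it is
    visibly continuous. Outside the polygon the weight of w is negative. *)
Definition cone w q : W -> R := fun z =>
  \sum_(j < k w) (z == c w j)%:R * hatw w j q +
  (z == w)%:R * (1 - \sum_(j < k w) hatw w j q).

Lemma cone_tri w i a b : 0 <= a -> 0 <= b ->
  cone w (a *: rayw w i%:R + b *: rayw w (i%:R + 1)) = tri w i a b.
Proof.
move=> a0 b0; apply/funext => z; rewrite /cone.
rewrite (sum_hat (k_gt4 w) (f := fun j => (z == c w j)%:R) (g := id)) //; last first.
  by move=> j; rewrite cDk.
have := sum_hat (k_gt4 w) (f := fun=> 1) (g := id) i (fun=> erefl) erefl a0 b0.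
rewrite !mul1r; under eq_bigr do rewrite mul1r.
by move=> ->; rewrite /tri; ring.
Qed.

Lemma cone_c w q j : (j < k w)%N -> cone w q (c w j) = hatw w j q.
Proof.
move=> jk; rewrite /cone (negbTE (c_neq _ _)) mul0r addr0.
rewrite (bigD1 (Ordinal jk)) //= eqxx mul1r big1 ?addr0 // => l lj.
by rewrite c_eq !modn_small // -[_ == _]/(Ordinal jk == l) eq_sym (negbTE lj) mul0r.
Qed.

Lemma sum_tri w (g : R -> R) (F : nat -> R) i a b : 0 <= a -> 0 <= b ->
  g 0 = 0 -> (forall j, F (j + k w)%N = F j) ->
  \sum_(j < k w) F j * g (tri w i a b (c w j)) = F i * g a + F i.+1 * g b.
Proof.
move=> a0 b0 g0 Fk; rewrite -(sum_hat (k_gt4 w)) //.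
by apply: eq_bigr => j _; rewrite -cone_tri // cone_c.
Qed.

Lemma ray_natDk w j : rayw w (j + k w)%:R = rayw w j%:R.
Proof. by rewrite natrD rayDk. Qed.

(** The linear map taking w to the origin and its j-th neighbour to the j-th ray; the star of w
    becomes an open regular polygon. *)
Definition star_map w (x : W -> R) : plane R :=
  (\sum_(j < k w) (rayw w j%:R).1 * x (c w j),
   \sum_(j < k w) (rayw w j%:R).2 * x (c w j)).

Lemma star_map_tri w i a b : 0 <= a -> 0 <= b ->
  star_map w (tri w i a b) = a *: rayw w i%:R + b *: rayw w (i%:R + 1).
Proof.
move=> a0 b0; rewrite natr1 /star_map; congr pair.
  rewrite (@sum_tri w id (fun j => (rayw w j%:R).1)) // => [|j]; last by rewrite ray_natDk.
  by rewrite /= /GRing.scale /=; ring.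
rewrite (@sum_tri w id (fun j => (rayw w j%:R).2)) // => [|j]; last by rewrite ray_natDk.
by rewrite /= /GRing.scale /=; ring.
Qed.

Definition disc_point w q : W -> R := fun z =>
  \sum_(j < k w) (z == c w j)%:R * polar_hat (k w) j%:R q +
  (z == w)%:R * (1 - modulus q).

Lemma disc_point_tri w i r t : 0 <= r -> 0 <= t <= 1 ->
  disc_point w (r *: rayw w (i%:R + t)) = tri w i (r * (1 - t)) (r * t).
Proof.
move=> r0 t01; apply/funext => z; rewrite /disc_point.
rewrite (polar_sum (k_gt4 w) (f := fun j => (z == c w j)%:R)) //; last first.
  by move=> j; rewrite cDk.
rewrite modulusZ // /tri addrC addrA; congr (_ * _ + _ + _); ring.
Qed.

(** Here s is the distance to the origin, and x (c w j) / s is the fraction of the sector that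
    becomes an angle. At the vertex w itself s = 0, and all terms vanish whatever the quotient. *)
Definition disc_inv w (x : W -> R) : plane R :=
  let s := 1 - x w in let th := sector_angle R (k w) in
  (\sum_(j < k w) (rayw w j%:R).1 * (s * sin (th * x (c w j) / s) / sin th),
   \sum_(j < k w) (rayw w j%:R).2 * (s * sin (th * x (c w j) / s) / sin th)).

Lemma disc_inv_tri w i r t : 0 <= r -> 0 <= t <= 1 ->
  disc_inv w (tri w i (r * (1 - t)) (r * t)) = r *: rayw w (i%:R + t).
Proof.
move=> r0 /andP[t0 t1]; rewrite /disc_inv tri_w.
have -> : 1 - (1 - r * (1 - t) - r * t) = r by ring.
have g0 : r * sin (sector_angle R (k w) * 0 / r) / sin (sector_angle R (k w)) = 0.
  by rewrite mulr0 mul0r sin0 mulr0 mul0r.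
pose g y := r * sin (sector_angle R (k w) * y / r) / sin (sector_angle R (k w)).
rewrite -(ray_polar (k_gt4 w)) ?t0 //.
rewrite natr1 -/(g (r * (1 - t))) -/(g (r * t)); congr pair.
  rewrite (@sum_tri w g (fun j => (rayw w j%:R).1)) //.
  - by rewrite /= /GRing.scale /=; ring.
  - by rewrite mulr_ge0 //; lra.
  - by rewrite mulr_ge0.
  - by move=> j; rewrite ray_natDk.
rewrite (@sum_tri w g (fun j => (rayw w j%:R).2)) //.
- by rewrite /= /GRing.scale /=; ring.
- by rewrite mulr_ge0 //; lra.
- by rewrite mulr_ge0.
- by move=> j; rewrite ray_natDk.
Qed.

Lemma tri_polar w i a b : 0 <= a -> 0 <= b -> exists r t : R,
  [/\ 0 <= t <= 1, r = a + b & tri w i a b = tri w i (r * (1 - t)) (r * t)].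
Proof.
move=> a0 b0; have [ab|ab] := eqVneq (a + b) 0.
  exists 0, 0; have [-> ->] : a = 0 /\ b = 0 by split; lra.
  by split; rewrite ?lexx ?ler01 ?addr0 // !mul0r.
have ab0 : 0 < a + b by rewrite lt_neqAle eq_sym ab addr_ge0.
exists (a + b), (b / (a + b)); split => //.
  by rewrite ler_pdivrMr // mul1r lerDr a0 andbT divr_ge0 // addr_ge0.
by congr tri; field.
Qed.

Lemma cone_z_continuous w z : continuous (fun q => cone w q z).
Proof.
apply: cts_add; first by apply: continuous_sum => j; apply: cts_mul;
  [exact: cts_cst|exact: hat_continuous].
apply: cts_mul; first exact: cts_cst.
apply: cts_sub; first exact: cts_cst.
by apply: continuous_sum => j; exact: hat_continuous.
Qed.

Lemma disc_point_z_continuous w z : continuous (fun q => disc_point w q z).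
Proof.
apply: cts_add; first by apply: continuous_sum => j; apply: cts_mul;
  [exact: cts_cst|exact: polar_hat_continuous].
apply: cts_mul; first exact: cts_cst.
by apply: cts_sub; [exact: cts_cst|exact: modulus_continuous].
Qed.

(** * The surface, its charts and its discs *)

Variable v0 : W.

Lemma vertex_points w : points (tri w 0 0 0).
Proof. by apply: tri_points; rewrite ?addr0. Qed.

Let S : topologicalType := set_type points.
(** The vertex v0, both the default value of [realize] and the common point of the discs in
    [complex_connected]. *)
Let base : S := exist _ (tri v0 0 0 0) (mem_set (vertex_points v0)).
Definition realize : (W -> R) -> S := to_subspace base.

Lemma realizeK (x : W -> R) : points x -> \val (realize x) = x.
Proof. exact: to_subspaceK. Qed.

Lemma val_points (x : S) : points (\val x).
Proof. exact/set_mem/valP. Qed.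

Lemma cone_inv w (x : W -> R) : points x -> 0 < x w ->
  cone w (star_map w x) = x.
Proof.
by move=> px /(starP px)[i [a [b [a0 b0 _ ->]]]]; rewrite star_map_tri // cone_tri.
Qed.

Lemma cone_image w q : \sum_(j < k w) hatw w j q < 1 ->
  [/\ points (cone w q), 0 < cone w q w & star_map w (cone w q) = q].
Proof.
have [a [b [i [a0 b0 ->]]]] := coneP (k_gt4 w) q.
have := sum_hat (k_gt4 w) (f := fun=> 1) (g := id) i (fun=> erefl) erefl a0 b0.
rewrite !mul1r; under eq_bigr do rewrite mul1r.
move=> -> ab; rewrite cone_tri // star_map_tri // tri_w; split => //; last by lra.
by apply: tri_points => //; exact: ltW.
Qed.

Lemma star_map_image w (x : W -> R) : points x -> 0 < x w ->
  \sum_(j < k w) hatw w j (star_map w x) < 1.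
Proof.
move=> px xw; have : 0 < cone w (star_map w x) w by rewrite cone_inv.
rewrite /cone eqxx mul1r big1 => [|j _]; last first.
  by rewrite eq_sym (negbTE (c_neq _ _)) mul0r.
by rewrite add0r subr_gt0.
Qed.

Lemma star_map_continuous w :
  continuous (fun x : S => star_map w (\val x)).
Proof.
have fc (f : nat -> R) :
    continuous (fun x : S => \sum_(j < k w) f j * coord (c w j) x).
  by apply: continuous_sum => j; apply: cts_mul; [exact: cts_cst|exact: coord_continuous].
move=> x; exact: (cvg_pair (fc (fun j => (rayw w j%:R).1) x) (fc (fun j => (rayw w j%:R).2) x)).
Qed.

Definition star w : set S := [set x | 0 < coord w x].

Lemma star_open w : open (star w).
Proof.
have /continuousP := @coord_continuous R W points w.
by move=> /(_ [set y | 0 < y]); apply; exact: open_gt.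
Qed.

Definition star_chart w (x : S) : plane R := star_map w (\val x).
Definition star_chart_inv w (q : plane R) : S := realize (cone w q).

Lemma star_chart_image w :
  star_chart w @` star w = [set q | \sum_(j < k w) hatw w j q < 1].
Proof.
apply/seteqP; split => [_ [x xw <-]|q /= /cone_image[pq qw qE]].
  by apply: star_map_image => //; exact: val_points.
exists (star_chart_inv w q); first by rewrite /star /= /coord realizeK.
by rewrite /star_chart realizeK.
Qed.

Lemma star_chart_img_open w : open (star_chart w @` star w).
Proof.
rewrite star_chart_image.
have /continuousP : continuous (fun q => \sum_(j < k w) hatw w j q).
  by apply: continuous_sum => j; exact: hat_continuous.
by move=> /(_ [set y | y < 1]); apply; exact: open_lt.
Qed.

Lemma star_chartK w : {in star w, cancel (star_chart w) (star_chart_inv w)}.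
Proof.
move=> x /set_mem xw; rewrite /star_chart_inv /star_chart cone_inv //.
  exact: valK_subspace.
exact: val_points.
Qed.

Lemma star_chart_homeo w :
  homeomorphism (star w) (star_chart w @` star w) (star_chart w) (star_chart_inv w).
Proof.
split => //; first exact: star_chartK.
  exact/continuous_subspaceT/star_map_continuous.
apply: to_subspace_continuous; last by move=> z; exact: cone_z_continuous.
by move=> q; rewrite star_chart_image => /cone_image[].
Qed.

Definition chart_at w : chart R S :=
  Chart (@star_open w) (@star_chart_img_open w) (star_chart_homeo w).

Lemma points_star (x : S) : exists w, star w x.
Proof.
apply: contrapT => /forallNP no_star.
have [x0 x1 _] := val_points x.
have : \sum_z \val x z = 0.
  apply: big1 => z _; apply/eqP; rewrite eq_le x0 andbT leNgt; apply/negP.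
  exact: no_star.
by rewrite x1 => /eqP; rewrite oner_eq0.
Qed.

Definition disc_map w (q : plane R) : S := realize (disc_point w q).

Lemma disc_point_points w q : closed_disc (origin R) 1 q ->
  points (disc_point w q).
Proof.
rewrite discE; have [r [t [i [r0 t01 ->]]]] := sectorP (k_gt4 w) q.
rewrite modulusZ // disc_point_tri // => r1; move/andP: t01 => [t0 t1].
by apply: tri_points; rewrite ?mulr_ge0 //; lra.
Qed.

Lemma disc_map_continuous w :
  {within closed_disc (origin R) 1, continuous (disc_map w)}.
Proof.
apply: to_subspace_continuous; last by move=> z; exact: disc_point_z_continuous.
exact: disc_point_points.
Qed.

Lemma disc_map_tri w i a b (x : S) : 0 <= a -> 0 <= b -> a + b <= 1 ->
  \val x = tri w i a b ->
  exists q, [/\ modulus q = a + b, disc_map w q = x & disc_inv w (\val x) = q].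
Proof.
move=> a0 b0 ab; have [r [t [t01 rE ->]]] := tri_polar w i a0 b0.
have r0 : 0 <= r by rewrite rE addr_ge0.
move=> xE; exists (r *: rayw w (i%:R + t)); split.
- by rewrite modulusZ // rE.
- by rewrite /disc_map disc_point_tri // -xE; exact: valK_subspace.
- by rewrite xE disc_inv_tri.
Qed.

(** The coordinates add up to 1, so that some coordinate is positive: the finitely many images of
    the closed disc cover S. *)
Lemma complex_compact : compact [set: S].
Proof.
rewrite (_ : [set: S] = \big[setU/set0]_(w <- enum W)
    (disc_map w @` closed_disc (origin R) 1)); last first.
  apply/seteqP; split => // x _; rewrite -bigcup_seq /=.
  have [w xw] := points_star x; exists w; first by rewrite /= mem_enum.
  have [i [a [b [a0 b0 ab xE]]]] := starP (val_points x) xw.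
  have [q [qE qx _]] := disc_map_tri a0 b0 (ltW ab) xE.
  by exists q => //; rewrite discE qE ltW.
apply: bigsetU_compact => w _; apply: continuous_compact; last exact: disc_compact.
exact: disc_map_continuous.
Qed.

(** The closed discs around the neighbours of v0 all contain v0, and they cover S because every
    triangle has such a neighbour as a corner. *)
Lemma complex_connected :
  (forall w i, exists z, z \in simplex w i /\ exists j, c z j = v0) ->
  connected [set: S].
Proof.
move=> hub; pose P z := exists j, c z j = v0.
rewrite (_ : [set: S] = \bigcup_(z in P) (disc_map z @` closed_disc (origin R) 1)).
  apply: bigcup_connected => [|z _]; last first.
    apply: connected_continuous_connected; first exact: disc_connected.
    exact: disc_map_continuous.
  exists base => z [j jv].
  have baseE : \val base = tri z j 1 0.
    apply/funext => y; rewrite /tri jv /= /tri !subr0 subrr !mulr0 !addr0.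
    by rewrite add0r.
  have ab1 : 1 + 0 <= 1 :> R by rewrite addr0.
  have [q [qE qx _]] := disc_map_tri ler01 (lexx 0) ab1 baseE.
  by exists q => //; rewrite discE qE addr0.
apply/seteqP; split => // x _.
have [_ _ [w [i supp]]] := val_points x.
have [z [zw Pz]] := hub w i; exists z => //.
have [j [a [b [a0 b0 ab xE]]]] := simplexP (val_points x) supp zw.
have [q [qE qx _]] := disc_map_tri a0 b0 ab xE.
by exists q => //; rewrite discE qE.
Qed.

Lemma disc_map_homeo w : homeomorphism (open_disc (origin R) 1) (star w)
  (disc_map w) (fun x => disc_inv w (\val x)).
Proof.
have opE q : open_disc (origin R) 1 q -> closed_disc (origin R) 1 q.
  by rewrite open_discE discE => /ltW.
split.
- apply/seteqP; split => [_ [q q1 <-]|x xw].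
    rewrite /star /= /coord realizeK; last exact/disc_point_points/opE.
    rewrite /disc_point eqxx mul1r big1 => [|j _]; last first.
      by rewrite eq_sym (negbTE (c_neq _ _)) mul0r.
    by rewrite add0r subr_gt0 -open_discE.
  have [i [a [b [a0 b0 ab xE]]]] := starP (val_points x) xw.
  have [q [qE qx _]] := disc_map_tri a0 b0 (ltW ab) xE.
  by exists q => //; rewrite open_discE qE.
- move=> q /set_mem /opE qd; rewrite /disc_map realizeK; last exact: disc_point_points.
  have [r [t [i [r0 t01 ->]]]] := sectorP (k_gt4 w) q.
  by rewrite disc_point_tri // disc_inv_tri.
- exact/(continuous_subspaceW opE)/disc_map_continuous.
apply: continuous_subspaceT => x.
have sc : continuous (fun x : S => 1 - coord w x).
  by apply: cts_sub; [exact: cts_cst|exact: coord_continuous].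
have fc (f : nat -> R) : continuous (fun x : S => \sum_(j < k w) f j *
    ((1 - coord w x) * sin (sector_angle R (k w) * coord (c w j) x / (1 - coord w x))
      / sin (sector_angle R (k w)))).
  apply: continuous_sum => j; apply: cts_mul; first exact: cts_cst.
  apply: cts_mul; last exact: cts_cst.
  (* The denominator vanishes at the vertex w, where the bound on the sine takes over. *)
  apply: (continuous_perspective (f := @sin R) (C := 1)) => //.
  - by apply: cts_mul; [exact: cts_cst|exact: coord_continuous].
  - exact: continuous_sin.
  - exact: sin_max.
exact: (cvg_pair (fc (fun j => (rayw w j%:R).1) x) (fc (fun j => (rayw w j%:R).2) x)).
Qed.

Lemma complex_surface :
  (forall w i, exists z, z \in simplex w i /\ exists j, c z j = v0) ->
  surface R S.
Proof.
move=> hub; split.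
- exact: set_type_hausdorff.
- exact: complex_compact.
- exact: complex_connected.
by move=> x; have [w xw] := points_star x; exists (chart_at w).
Qed.

(** * Transition maps and orientability *)

Lemma ray_mod w i j : i = j %[mod k w] -> rayw w i%:R = rayw w j%:R.
Proof.
have red n : rayw w n%:R = rayw w (n %% k w)%:R.
  by rewrite {1}(divn_eq n (k w)) addnC; elim: (_ %/ _)%N => [|m IH];
    rewrite ?mul0n ?addn0 // mulSn addnCA addnC ray_natDk.
by move=> ij; rewrite red ij -red.
Qed.

Lemma eqn_mod_succ m i j : (i.+1 == j.+1 %[mod m]) = (i == j %[mod m]).
Proof. by rewrite -(addn1 i) -(addn1 j) eqn_modDr. Qed.

Lemma modn_succ m i j : i = j %[mod m] -> i.+1 = j.+1 %[mod m].
Proof. by move=> /eqP ij; apply/eqP; rewrite eqn_mod_succ. Qed.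

Lemma ray_succ_mod w i j : i = j %[mod k w] ->
  rayw w (i%:R + 1) = rayw w (j%:R + 1).
Proof. by move=> ij; rewrite !natr1; exact/ray_mod/modn_succ. Qed.

(* On the intersection of two adjacent stars, which is the union of two
   triangles and of their common edge. *)
Lemma kite w i (x : W -> R) : points x -> 0 < x w -> 0 < x (c w i.+1) ->
  [/\ star_map w x = x (c w i) *: rayw w i%:R + x (c w i.+1) *: rayw w (i%:R + 1) +
        x (c w i.+2) *: rayw w (i%:R + 2),
      x (c w i) = 0 \/ x (c w i.+2) = 0 &
      x w + x (c w i) + x (c w i.+1) + x (c w i.+2) = 1].
Proof.
move=> px xw xi; have [j [a [b [a0 b0 ab xE]]]] := starP px xw.
have kw := k_gt4 w.
have r12 : rayw w (i%:R + 2) = rayw w (i.+1%:R + 1).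
  by rewrite -[i.+1%:R]natr1 -addrA.
have succ_neq n : (c w n == c w n.+2) = false.
  rewrite c_eq -addn2 -[X in X == _ %[mod _]]addn0 eqn_modDl !modn_small //; lia.
have xc n : x (c w n) = (n == j %[mod k w])%:R * a + (n == j.+1 %[mod k w])%:R * b.
  by rewrite xE /tri (negbTE (c_neq _ _)) mul0r add0r !c_eq.
have xwE : x w = 1 - a - b by rewrite xE tri_w.
have mapE : star_map w x = a *: rayw w j%:R + b *: rayw w (j%:R + 1).
  by rewrite xE star_map_tri.
have nS n : (n == n.+1 %[mod k w]) = false.
  by rewrite -c_eq eq_sym (negbTE (c_succ_neq _ _)).
have nSS n : (n == n.+2 %[mod k w]) = false by rewrite -c_eq succ_neq.
(* The sector j containing x has the ray i + 1 as a side, so that j is i + 1 or i modulo [k w]: the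
   two triangles of the kite. *)
have [ij|ij] := eqVneq (i.+1 %% k w)%N (j %% k w)%N.
  have ij2 : i.+2 = j.+1 %[mod k w] by exact: modn_succ.
  have xi0 : x (c w i) = 0.
    by rewrite xc -ij -ij2 nS nSS !mul0r addr0.
  have xi1 : x (c w i.+1) = a.
    by rewrite xc -ij eqxx -ij2 nS mul1r mul0r addr0.
  have xi2 : x (c w i.+2) = b.
    by rewrite xc -ij2 eqxx -ij eq_sym nS mul1r mul0r add0r.
  rewrite xi0 xi1 xi2 scale0r add0r r12 [i%:R + 1]natr1 (ray_mod ij)
    (ray_succ_mod ij) mapE.
  by split => //; [left|rewrite xwE; ring].
have [ij2|ij2] := eqVneq (i.+1 %% k w)%N (j.+1 %% k w)%N; last first.
  by move: xi; rewrite xc (negbTE ij) (negbTE ij2) !mul0r addr0 ltxx.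
have {}ij : i = j %[mod k w] by apply/eqP; rewrite -eqn_mod_succ ij2.
have xi0 : x (c w i) = a by rewrite xc ij eqxx -ij2 -ij nS mul1r mul0r addr0.
have xi1 : x (c w i.+1) = b.
  by rewrite xc ij2 eqxx -ij2 -ij eq_sym nS mul1r mul0r add0r.
have xi2 : x (c w i.+2) = 0.
  by rewrite xc -ij2 -ij eq_sym nSS eq_sym nS !mul0r addr0.
rewrite xi0 xi1 xi2 mapE scale0r addr0 (ray_mod ij) (ray_succ_mod ij).
by split => //; [right|rewrite xwE; ring].
Qed.

(** Seen from w' = [c w i.+1], the far corners of the two triangles on the edge ww' appear in the
    reverse order, with w between them. Each triangle yields one half of this, and [c_eq] joins the
    halves at w. *)
Lemma link_edge w i : exists l,
  [/\ c (c w i.+1) l = c w i.+2, c (c w i.+1) l.+1 = w &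
      c (c w i.+1) l.+2 = c w i].
Proof.
have [l [h1 h2]] := c_tri w i.+1; exists l; split => //.
have [l1 [h3 h4]] := c_tri w i.
have := c_tri (c w i) l1; rewrite h3 h4 => -[l2 [h5 h6]].
rewrite -h6; apply: c_mod; apply: modn_succ; apply/eqP.
by rewrite -c_eq h2 h5.
Qed.

Lemma star_adjacent w w' (x : W -> R) : points x -> 0 < x w -> 0 < x w' ->
  w' != w -> exists i, w' = c w i.+1.
Proof.
move=> px xw xw' ww'; have [i [a [b [_ _ _ xE]]]] := starP px xw.
move: xw'; rewrite xE /tri (negbTE ww') mul0r add0r.
have [-> _|_] := eqVneq w' (c w i); last first.
  have [-> _|_] := eqVneq w' (c w i.+1); last by rewrite !mul0r addr0 ltxx.
  by exists i.
(* This is i - 1 modulo [k w], also meaningful when i is 0. *)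
exists (i + (k w).-1)%N; apply: c_mod.
by rewrite -addnS prednK ?modnDr //; have := k_gt4 w; lia.
Qed.

Lemma transition_continuous w w' p r :
  continuous (fun t => (star_map w' (cone w (p + r *: e t))).1) /\
  continuous (fun t => (star_map w' (cone w (p + r *: e t))).2).
Proof.
have ec : continuous (fun t => p + r *: e t).
  rewrite (_ : (fun _ => _) = fun t => (p.1 + r * cos t, p.2 + r * sin t)) // => t.
  have c1 : continuous (fun t => p.1 + r * cos t).
    apply: cts_add; first exact: cts_cst.
    by apply: cts_mul; [exact: cts_cst|exact: continuous_cos].
  have c2 : continuous (fun t => p.2 + r * sin t).
    apply: cts_add; first exact: cts_cst.
    by apply: cts_mul; [exact: cts_cst|exact: continuous_sin].
  exact: (cvg_pair (c1 t) (c2 t)).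
have cc z : continuous (fun t => cone w (p + r *: e t) z).
  move=> t; apply: (@continuous_comp _ _ _ (fun t => p + r *: e t) (fun q => cone w q z)).
    exact: ec.
  exact: cone_z_continuous.
by split; apply: continuous_sum => j; apply: cts_mul => //; exact: cts_cst.
Qed.

Lemma transition_orientation w w' : orientation_preserving
  (star_chart w @` (star w `&` star w')) (star_chart w' \o star_chart_inv w).
Proof.
set U := star_chart w @` _ => p Up.
have UE q : U q -> exists x, [/\ points x, 0 < x w, 0 < x w',
    q = star_map w x & (star_chart w' \o star_chart_inv w) q = star_map w' x].
  move=> [x [xw xw'] <-]; exists (\val x); split => //; first exact: val_points.
  by rewrite /= star_chartK // inE.
(* In the plane, the overlap is the part of the polygon where the weight of w' in [cone w] is
   positive. *)
have Uo : open U.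
  rewrite (_ : U = [set q | \sum_(j < k w) hatw w j q < 1] `&`
      [set q | 0 < cone w q w']).
    apply: openI; first by rewrite -star_chart_image; exact: star_chart_img_open.
    have /continuousP := @cone_z_continuous w w'.
    by move=> /(_ [set y | 0 < y]); apply; exact: open_gt.
  apply/seteqP; split => [q /UE[x [px xw xw' -> _]]|q [/cone_image[pq qw qE] /= qw']].
    by split; [exact: star_map_image|rewrite /= cone_inv].
  exists (realize (cone w q)); last by rewrite /star_chart realizeK.
  by split; rewrite /star /= /coord realizeK.
have [r r0 rU] := open_closed_disc Uo Up.
exists r; split => //.
have circle t : U (p + r *: e t).
  apply: rU; rewrite /closed_disc /= /GRing.scale /= !(addrC p.1) !(addrC p.2) !addrK.
  by rewrite !exprMn -mulrDr cos2Dsin2 mulr1.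
have hE t : (star_chart w' \o star_chart_inv w) (p + r *: e t) =
    star_map w' (cone w (p + r *: e t)).
  by have [x [px xw _ -> ->]] := UE _ (circle t); rewrite cone_inv.
have [tc1 tc2] := transition_continuous w w' p r.
have [mu0 [mu1 [crossP dotP]]] : exists mu0 mu1, 
    (forall t, sin (t - mu0) != 0 -> 0 < cross (e mu1)
      ((star_chart w' \o star_chart_inv w) (p + r *: e t) -
       (star_chart w' \o star_chart_inv w) p) * sin (t - mu0)) /\
    (forall t, sin (t - mu0) = 0 -> 0 < dot (e mu1)
      ((star_chart w' \o star_chart_inv w) (p + r *: e t) -
       (star_chart w' \o star_chart_inv w) p) * cos (t - mu0)); last first.
  apply: (winds_onceP (mu0 := mu0) (mu1 := mu1)) => //.
    by under eq_fun do rewrite hE.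
  by under eq_fun do rewrite hE.
have [x0 [px0 x0w x0w' pE hpE]] := UE _ Up.
rewrite hpE; clear hE tc1 tc2.
(* On a single star the transition is the identity, and any common direction would do. *)
have [ww'|ww'] := eqVneq w' w.
  subst w'; exists 0, 0; split => t; rewrite subr0 => st;
    have [x [px xw _ qE ->]] := UE _ (circle t); rewrite -qE -pE addrC addKr.
    rewrite /cross /= cos0 sin0 mul1r mul0r subr0 -mulrA mulr_gt0 //.
    by rewrite -expr2 lt_neqAle sqr_ge0 andbT eq_sym sqrf_eq0.
  rewrite /dot /= cos0 sin0 mul1r mul0r addr0 -mulrA mulr_gt0 //.
  rewrite -expr2 lt_neqAle sqr_ge0 andbT eq_sym sqrf_eq0.
  by have := cos2Dsin2 t; rewrite st => h; apply/eqP => ct; move: h; rewrite ct; lra.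
have [i wi] := star_adjacent px0 x0w x0w' ww'; subst w'.
have [l [h1 h2 h3]] := link_edge w i.
set w' := c w i.+1 in UE *.
pose th := sector_angle R (k w); pose th' := sector_angle R (k w').
(* Both angles give the direction from w to w'. Around w' the ray l + 1 points back to w, hence the
   added pi. *)
exists (th * (i%:R + 1)), (th' * (l%:R + 1) + pi).


have sinBpi s m : sin (s - (m + pi)) = - sin (s - m) :> R.
  by rewrite (_ : s - m = s - (m + pi) + pi) ?sinDpi ?opprK //; ring.
have cosBpi s m : cos (s - (m + pi)) = - cos (s - m) :> R.
  by rewrite (_ : s - m = s - (m + pi) + pi) ?cosDpi ?opprK //; ring.
pose X (x : W -> R) := x (c w i.+2) - x (c w i).
have mapE x : points x -> 0 < x w -> 0 < x w' ->
  [/\ cross (e (th * (i%:R + 1))) (star_map w x) = sin th * X x,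
      cross (e (th' * (l%:R + 1) + pi)) (star_map w' x) = sin th' * X x,
      dot (e (th * (i%:R + 1))) (star_map w x) =
        x w' + cos th * (x (c w i) + x (c w i.+2)) &
      dot (e (th' * (l%:R + 1) + pi)) (star_map w' x) =
        - x w - cos th' * (x (c w i) + x (c w i.+2))].
  move=> px xw xw'; have [-> _ _] := kite px xw xw'.
  have xlw : 0 < x (c w' l.+1) by rewrite h2.
  have [-> _ _] := kite px xw' xlw; rewrite h1 h2 h3 /ray.
  rewrite !cross_comb3 !dot_comb3 !sinBpi !cosBpi -!mulrBr.
  rewrite (_ : i%:R - (i%:R + 1) = -1 :> R); last by ring.
  rewrite (_ : i%:R + 2 - (i%:R + 1) = 1 :> R); last by ring.
  rewrite (_ : l%:R - (l%:R + 1) = -1 :> R); last by ring.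
  rewrite (_ : l%:R + 2 - (l%:R + 1) = 1 :> R); last by ring.
  rewrite !subrr !mulr0 !mulr1 !mulrN1 !sinN !cosN sin0 cos0 /X.
  by split; ring.
have sth : 0 < sin th := sin_sector_gt0 R (k_gt4 w).
have sth' : 0 < sin th' := sin_sector_gt0 R (k_gt4 w').
have [c0 s0 d0 e0] := mapE _ px0 x0w x0w'.
have [_ z0 t0] := kite px0 x0w x0w'.
have [n0 _ _] := px0.
split => t st; have [x [px xw xw' qE ->]] := UE _ (circle t);
    have [c1 s1 d1 e1] := mapE _ px xw xw';
    have [_ z1 t1] := kite px xw xw'; have [n1 _ _] := px;
    have dE : r *: e t = star_map w x - star_map w x0 by rewrite -qE -pE addrC addKr.
  have : r * sin (t - th * (i%:R + 1)) = sin th * (X x - X x0).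
    by rewrite -cross_circleZ dE crossB c1 c0; ring.
  rewrite crossB s1 s0 -mulrBr; move: (sin (t - _)) st (X x - X x0) => s s_n0 D rs.
  rewrite -mulrA mulr_gt0 // -(pmulr_rgt0 _ sth) mulrA -rs -mulrA mulr_gt0 //.
  by rewrite -expr2 lt_neqAle sqr_ge0 andbT eq_sym sqrf_eq0.
have : r * sin (t - th * (i%:R + 1)) = sin th * (X x - X x0).
  by rewrite -cross_circleZ dE crossB c1 c0; ring.
rewrite st mulr0 => /esym/eqP; rewrite mulf_eq0 gt_eqF //= subr_eq0 => /eqP XE.
(* When the displacement is parallel to the edge, the far corners keep their weights. Only weight
   exchanged between w and w' remains, and it moves the point equally along the edge in both
   charts. *)
have [q1 q2] : x (c w i) = x0 (c w i) /\ x (c w i.+2) = x0 (c w i.+2).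
  exact: disjoint_sub_inj (n1 _) (n1 _) (n0 _) (n0 _) z1 z0 XE.
have rc : r * cos (t - th * (i%:R + 1)) = x w' - x0 w'.
  by rewrite -dot_circleZ dE dotB d1 d0 q1 q2; ring.
have -> : dot (e (th' * (l%:R + 1) + pi)) (star_map w' x - star_map w' x0) =
    r * cos (t - th * (i%:R + 1)).
  rewrite rc dotB e1 e0 q1 q2; move: t0 t1; rewrite -/w' q1 q2; lra.
rewrite -mulrA mulr_gt0 // -expr2 lt_neqAle sqr_ge0 andbT eq_sym sqrf_eq0.
have := cos2Dsin2 (t - th * (i%:R + 1)); rewrite st => h; apply/eqP => ct.
by move: h; rewrite ct; lra.
Qed.

Lemma complex_orientable : orientable R S.
Proof.
exists (range chart_at); split.
  by move=> x; have [w xw] := points_star x; exists (chart_at w); [exists w|].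
by move=> _ _ [w _ <-] [w' _ <-]; exact: transition_orientation.
Qed.

End Complex.

(** * The graph of the vertices which are not centres of faces *)

Lemma cycle_zip (T : Type) (r : rel T) (s : seq T) :
  cycle r s = all (fun p => r p.1 p.2) (zip s (rot 1 s)).
Proof.
case: s => // x s; rewrite rot1_cons /=.
suff H y : path r x (rcons s y) = all (fun p => r p.1 p.2) (zip (x :: s) (rcons s y)).
  exact: H.
by elim: s x => [|z s IH] x /=; rewrite ?IH.
Qed.

Lemma nth_rot1_mkseq (T : Type) (x0 : T) (g : nat -> T) n j : (j < n)%N ->
  (forall i, g (i + n)%N = g i) -> nth x0 (rot 1 (mkseq g n)) j = g j.+1.
Proof.
case: n => // n jn gn; rewrite /mkseq [iota _ _]/= map_cons rot1_cons nth_rcons.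
rewrite size_map size_iota; move: jn; rewrite ltnS leq_eqVlt => /orP[/eqP->|jn].
  by rewrite ltnn eqxx -(gn 0%N) add0n.
by rewrite jn (nth_map 0%N) ?size_iota // nth_iota.
Qed.

Lemma zip_rot1_mkseq (T : Type) (g : nat -> T) n :
  (forall i, g (i + n)%N = g i) ->
  zip (mkseq g n) (rot 1 (mkseq g n)) = [seq (g j, g j.+1) | j <- iota 0 n].
Proof.
move=> gn; have sz : size (mkseq g n) = size (rot 1 (mkseq g n)).
  by rewrite size_rot.
apply: (@eq_from_nth _ (g 0%N, g 0%N)).
  by rewrite size_zip size_rot minnn size_mkseq size_map size_iota.
rewrite size_zip size_rot minnn size_mkseq => j jn.
rewrite nth_zip // nth_mkseq // nth_rot1_mkseq //.
by rewrite (nth_map 0%N) ?size_iota // nth_iota.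
Qed.

(* Vertices of the complex are those of the graph (inl) or centres of faces
   (inr); cf f is the boundary walk of the face f. The orientation dir of the
   edges is followed by the faces of one colour, counterclockwise, and opposed
   by those of the other one. *)
Section GraphOnComplex.
Variables (R : realType) (V F : finType).
Let W : finType := (V + F)%type.
Variables (k : W -> nat) (c : W -> nat -> W).
Hypothesis k_gt4 : forall w, (4 < k w)%N.
Hypothesis c_eq : forall w i j, (c w i == c w j) = (i == j %[mod k w]).
Hypothesis c_neq : forall w i, c w i != w.
Hypothesis c_tri : forall w i,
  exists l, c (c w i) l = c w i.+1 /\ c (c w i) l.+1 = w.
Variables (n : nat) (cf : F -> nat -> V) (e dir : rel V) (col : F -> bool) (v0 : V).
Hypothesis kF : forall f, k (inr f) = n.
Hypothesis cF : forall f i, c (inr f) i = inl (cf f i).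
Hypothesis adjP : forall u v, e u v <-> exists i, c (inl u) i = inl v.
Hypothesis cV : forall u v i, c (inl u) i = inl v -> exists f, c (inl u) i.+1 = inr f.
Hypothesis dir_anti : forall u v, e u v -> dir v u = ~~ dir u v.
Hypothesis dir_col : forall f i, dir (cf f i) (cf f i.+1) = col f.
Hypothesis hub : forall f, exists i, cf f i = v0.

Lemma adj_neq u v : e u v -> u != v.
Proof.
move=> /adjP[i ci]; apply/eqP => uv; have := c_neq (inl u) i.
by rewrite ci -uv eqxx.
Qed.

(** The face following v around u lies to the left of the arc; turning this triangle twice with
    [c_tri] shows it from the centre of the face. *)
Lemma arc_face u v : e u v -> exists f i, cf f i = u /\ cf f i.+1 = v.
Proof.
move=> /adjP[i ci]; have [f cf1] := cV ci; exists f.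
have [l] := c_tri (inl u) i; rewrite ci cf1 => -[h1 h2].
have [l'] := c_tri (inl v) l; rewrite h1 h2 !cF => -[[h3] [h4]].
by exists l'.
Qed.

Lemma face_arc f i : exists l,
  c (inl (cf f i)) l = inl (cf f i.+1) /\ c (inl (cf f i)) l.+1 = inr f.
Proof. by have := c_tri (inr f) i; rewrite !cF. Qed.

Lemma face_adj f i : e (cf f i) (cf f i.+1).
Proof. by apply/adjP; have [l [h _]] := face_arc f i; exists l. Qed.

(** The head of the arc occurs once in the link of its tail, and the next entry there is the
    face. *)
Lemma arc_face_inj f i f' i' : cf f i = cf f' i' -> cf f i.+1 = cf f' i'.+1 ->
  f = f' /\ i = i' %[mod n].
Proof.
move=> h1 h2; have [l [h3 h4]] := face_arc f i; have [l' [h5 h6]] := face_arc f' i'.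
have ff' : f = f'.
  have /eqP : c (inl (cf f i)) l = c (inl (cf f i)) l' by rewrite h3 h1 h5 h2.
  rewrite c_eq => /eqP /modn_succ ll.
  by apply: (@inr_inj V); rewrite -h4 -h6 -h1; exact: c_mod ll.
split=> //; apply/eqP; rewrite -(kF f) -c_eq !cF; apply/eqP.
by rewrite h1 ff'.
Qed.

Lemma cfDn f i : cf f (i + n)%N = cf f i.
Proof. by apply: (@inl_inj V F); rewrite -!cF -(kF f) cDk. Qed.

Lemma simplex_face w i : exists f, inr f \in simplex c w i.
Proof.
case: w => [u|f]; last by exists f; rewrite inE eqxx.
case ci: (c (inl u) i) => [v|f]; last by exists f; rewrite !inE ci eqxx orbT.
by have [f cf1] := cV ci; exists f; rewrite !inE cf1 eqxx !orbT.
Qed.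

Lemma simplex_hub w i : exists z, z \in simplex c w i /\ exists j, c z j = inl v0.
Proof.
have [f fw] := simplex_face w i; exists (inr f); split => //.
by have [j jv] := hub f; exists j; rewrite cF jv.
Qed.

Local Notation S := (set_type (@points R W c)).

Definition ext (y : V -> R) : W -> R := fun z => if z is inl v then y v else 0.

Definition graph_map (y : {ptws V -> R}) : S := realize c (inl v0) (ext y).

Lemma ext_edge u v i t : c (inl u) i = inl v ->
  ext (edge_point u v t) = tri c (inl u) i t 0.
Proof.
move=> ci; apply/funext => z; rewrite /tri ci mulr0 addr0 subr0.
case: z => [z|f] /=; last by rewrite !mul0r addr0.
by rewrite /edge_point (mulrC (1 - t)) (mulrC t).
Qed.

Lemma realization_points y : realization e y -> points c (ext y).
Proof.
move=> [[v ->]|[u [v [/adjP[i ci] [t /= /andP[t0 t1] <-]]]]].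
  rewrite (_ : ext _ = tri c (inl v) 0 0 0); first exact: vertex_points.
  apply/funext => z; rewrite /tri !mulr0 !addr0 !subr0 mulr1.
  by case: z.
by rewrite (ext_edge _ ci); apply: tri_points; rewrite ?addr0.
Qed.

Lemma graph_embedding : embedding e graph_map.
Proof.
split.
  apply: (@to_subspace_continuous _ _ _ _ _ _ (fun y : {ptws V -> R} => ext y)).
    exact: realization_points.
  case=> [v|f] /=; last exact: cst_continuous.
  exact: ptws_eval_continuous.
move=> y y' /set_mem ry /set_mem ry' yy'; apply/funext => v.
have : ext y = ext y'.
  by rewrite -(realizeK (inl v0) (realization_points ry)) -/(graph_map y) yy' realizeK //;
    exact: realization_points.
by move/(congr1 (fun x => x (inl v))).
Qed.

Lemma tri_face f i a b : a + b = 1 ->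
  tri c (inr f) i a b = ext (edge_point (cf f i) (cf f i.+1) b).
Proof.
move=> ab; have aE : a = 1 - b by rewrite -ab addrK.
apply/funext => z; rewrite /tri !cF aE.
have -> : 1 - (1 - b) - b = 0 by ring.
rewrite mulr0 add0r; case: z => [z|g] /=; last by rewrite !mul0r addr0.
by rewrite /edge_point mulrC (mulrC b).
Qed.

Lemma starE (w : W) (x : S) : star w x = (0 < \val x w) :> Prop.
Proof. by []. Qed.

(** The link of a face centre contains no face centre, so that no triangle has two of them as
    corners. *)
Lemma star_face_other f f' (x : S) : star (inr f) x -> star (inr f') x -> f = f'.
Proof.
move=> xf; have [i [a [b [_ _ _ xE]]]] := starP k_gt4 c_eq c_neq c_tri (val_points x) xf.
rewrite starE xE /tri !cF /= !mul0r !addr0.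
have [[->]//|_] := eqVneq (inr f' : W) (inr f).
by rewrite mul0r ltxx.
Qed.

(** Every triangle has a face centre as a corner, and the opposite side is an edge of the graph: a
    point with no weight at that centre lies on the graph. *)
Lemma off_graph : ~` (graph_map @` realization e) = \bigcup_f star (inr f).
Proof.
apply/seteqP; split => x; last first.
  move=> [f _ xf] [y ry yx]; move: xf; rewrite -yx starE /graph_map realizeK.
    by rewrite ltxx.
  exact: realization_points.
move=> nx; apply: contrapT => xf; apply: nx.
have [x0 x1 [w [i supp]]] := val_points x.
have [f fw] := simplex_face w i.
have [j [a [b [a0 b0 ab xE]]]] :=
  simplexP k_gt4 c_eq c_neq c_tri (val_points x) supp fw.
have ab1 : a + b = 1.
  have : ~ (0 < \val x (inr f)) by move=> h; apply: xf; exists f.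
  by rewrite xE tri_w // => /negP; rewrite -leNgt; lra.
exists (edge_point (cf f j) (cf f j.+1) b).
  right; exists (cf f j), (cf f j.+1); split; first exact: face_adj.
  by exists b => //=; lra.
by rewrite /graph_map -(tri_face f j ab1) -xE; exact: valK_subspace.
Qed.

Lemma component_star f (x : S) : star (inr f) x ->
  connected_component (~` (graph_map @` realization e)) x = star (inr f).
Proof.
move=> xf; rewrite off_graph; apply/seteqP; split; last first.
  have [imE _ dc _] := disc_map_homeo R k_gt4 c_eq c_neq c_tri (inl v0) (inr f).
  apply: connected_component_max => //; first by move=> y yf; exists f.
  rewrite -imE; apply: connected_continuous_connected dc.
  exact: open_disc_connected.
set C := connected_component _ x.
have Cx : C x by apply: connected_component_refl; exists f.
have CE : C `<=` \bigcup_g star (inr g) by exact: connected_component_sub.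
suff <- : C `&` star (inr f) = C by move=> y [].
(* The star is open, and it is closed in the complement of the graph since the other stars are open
   and disjoint from it. *)
apply: (component_connected (A := \bigcup_g star (inr g)) (x := x)).
- by exists x.
- by exists (star (inr f)) => //; exact: star_open.
exists (~` \bigcup_(g in [set g | g <> f]) star (inr g)).
  by apply: open_closedC; apply: bigcup_open => g _; exact: star_open.
apply/seteqP; split => y [Cy].
  by move=> yf; split=> // -[g /= gf yg]; apply: gf; exact: star_face_other yg yf.
move=> ny; split => //; have [g _ yg] := CE _ Cy.
have [<-//|gf] := eqVneq g f.
by case: ny; exists g => //=; exact/eqP.
Qed.

Lemma star_nonempty f : exists x : S, star (inr f) x.
Proof.
exists (realize c (inl v0) (tri c (inr f) 0 0 0)).
by rewrite starE realizeK ?tri_w ?subr0 //; exact: vertex_points.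
Qed.

Lemma faceP (A : set S) : face e graph_map A <-> exists f, A = star (inr f).
Proof.
split=> [[x nx ->]|[f ->]].
  have [f _ xf] : (\bigcup_f star (inr f)) x by rewrite -off_graph.
  by exists f; exact: component_star.
have [x xf] := star_nonempty f; exists x; last by rewrite (component_star xf).
by rewrite -[~ _]/((~` _) _) off_graph; exists f.
Qed.

Lemma graph_cellular : cellular e graph_map.
Proof.
move=> _ /faceP[f ->].
by do 2 eexists; exact: (disc_map_homeo R k_gt4 c_eq c_neq c_tri (inl v0) (inr f)).
Qed.

Definition boundary f : seq V := mkseq (cf f) n.

Lemma star_bounded_by f : bounded_by graph_map (star (inr f)) (boundary f).
Proof.
exists (disc_map k c (inl v0) (inr f)), (fun x => disc_inv k c (inr f) (\val x)).
split.
- exact: disc_map_continuous.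
- exact: disc_map_homeo.
move=> x0 j t; rewrite size_mkseq => jn t01.
rewrite nth_mkseq // nth_rot1_mkseq //; last exact: cfDn.
have -> : circle_point (2 * pi * (j%:R + t) / n%:R) = 1 *: ray (k (inr f)) (j%:R + t).
  by rewrite scale1r /ray /sector_angle kF; congr circle_point; ring.
rewrite /disc_map disc_point_tri // !mul1r; congr to_subspace.
by apply: tri_face; rewrite subrK.
Qed.

(** The image of the closed disc is compact, hence closed in the Hausdorff space S, and it contains
    the star. *)
Lemma closure_star f (x : S) : closure (star (inr f)) x ->
  exists j a b, \val x = tri c (inr f) j a b.
Proof.
have [imE _ _ _] := disc_map_homeo R k_gt4 c_eq c_neq c_tri (inl v0) (inr f).
have cl : closed (disc_map k c (inl v0) (inr f) @` closed_disc (origin R) 1).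
  apply: compact_closed; first exact: set_type_hausdorff.
  by apply: continuous_compact; [exact: disc_map_continuous|exact: disc_compact].
move=> xcl; have [q qd <-] : (disc_map k c (inl v0) (inr f) @` closed_disc (origin R) 1) x.
  rewrite ((closure_id _).1 cl); move: x xcl; rewrite -imE; apply: closureS.
  by move=> _ [q q1 <-]; exists q => //; move: q1; rewrite open_discE discE => /ltW.
have [r [t [i [r0 t01 qE]]]] := sectorP (k_gt4 (inr f)) q.
exists i, (r * (1 - t)), (r * t); rewrite realizeK; last exact: disc_point_points.
by rewrite qE disc_point_tri.
Qed.

(* The midpoint of an edge lies on the boundary of a face only if the boundary
   circuit traverses the edge. *)
Lemma edge_in_closure f u v : e u v ->
  graph_map @` edge_segment u v `<=` closure (star (inr f)) ->
  exists i, (cf f i = u /\ cf f i.+1 = v) \/ (cf f i = v /\ cf f i.+1 = u).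
Proof.
move=> uv sub; set h : R := 2^-1.
have h0 : 0 < h by rewrite invr_gt0.
have h1 : h < 1 by rewrite invf_lt1 // ltr1n.
have seg : edge_segment u v (edge_point u v h).
  by exists h => //=; rewrite ltW //= ltW.
have rp : points c (ext (edge_point u v h)).
  by apply: realization_points; right; exists u, v.
have /sub/closure_star[j [a [b]]] :
  (graph_map @` edge_segment u v) (graph_map (edge_point u v h)).
  by exists (edge_point u v h).
rewrite /graph_map realizeK // => E; exists j.
have onf z : 0 < edge_point u v h z -> z = cf f j \/ z = cf f j.+1.
  rewrite -[edge_point u v h z]/(ext (edge_point u v h) (inl z)) E.
  rewrite /tri !cF /= mul0r add0r !(inj_eq (@inl_inj V F)).
  have [->|_] := eqVneq z (cf f j); first by left.
  have [->|_] := eqVneq z (cf f j.+1); first by right.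
  by rewrite !mul0r addr0 ltxx.
have /eqP nuv := adj_neq uv.
have /onf uf : 0 < edge_point u v h u.
  by rewrite /edge_point eqxx (negbTE (adj_neq uv)) mulr1 mulr0 addr0 subr_gt0.
have /onf vf : 0 < edge_point u v h v.
  by rewrite /edge_point eqxx eq_sym (negbTE (adj_neq uv)) mulr1 mulr0 add0r.
by case: uf vf nuv => -> [] -> // _; [left|right].
Qed.

(** Faces of one colour traverse an edge in the same sense, by [dir_col] and [dir_anti], and an arc
    has only one face to its left. Both the colouring and the disjointness of the circuits rest on
    this. *)
Lemma face_col_inj f f' i i' u v : col f = col f' ->
  (cf f i = u /\ cf f i.+1 = v) \/ (cf f i = v /\ cf f i.+1 = u) ->
  (cf f' i' = u /\ cf f' i'.+1 = v) \/ (cf f' i' = v /\ cf f' i'.+1 = u) ->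
  [/\ cf f i = cf f' i', cf f i.+1 = cf f' i'.+1, f = f' & i = i' %[mod n]].
Proof.
move=> ff' fi fi'.
suff [h1 h2] : cf f i = cf f' i' /\ cf f i.+1 = cf f' i'.+1.
  by have [h3 h4] := arc_face_inj h1 h2.
have := dir_col f i; have := dir_col f' i'; rewrite -ff'.
have := dir_anti (face_adj f i); have := dir_anti (face_adj f' i').
case: fi fi' => [] [-> ->] [] [-> ->] => [//|_|_|//].
  by move=> -> <- /eqP; case: (dir u v).
by move=> -> <- /eqP; case: (dir v u).
Qed.

Definition face_color (A : set S) : bool :=
  `[< exists2 f, A = star (inr f) & col f >].

Lemma face_colorE f : face_color (star (inr f)) = col f.
Proof.
apply/asboolP/idP => [[f' ff' cf']|]; last by exists f.
have [x xf] := star_nonempty f; have : star (inr f') x by rewrite -ff'.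
by move=> /(star_face_other xf) ->.
Qed.

Lemma graph_face_coloring : face_coloring e graph_map face_color.
Proof.
move=> _ _ u v /faceP[f ->] /faceP[f' ->] ff' uv uf uf'; rewrite !face_colorE => cff'.
have [i fi] := edge_in_closure uv uf; have [i' fi'] := edge_in_closure uv uf'.
by have [_ _ E _] := face_col_inj cff' fi fi'; apply: ff'; rewrite E.
Qed.

Lemma boundary_edges f :
  circuit_edges (boundary f) = [seq [set cf f j; cf f j.+1]%SET | j <- iota 0 n].
Proof.
rewrite /circuit_edges zip_rot1_mkseq; last exact: cfDn.
by rewrite -map_comp.
Qed.

Lemma set2_eq (T : finType) (a b a' b' : T) : [set a; b]%SET = [set a'; b']%SET ->
  (a' = a /\ b' = b) \/ (a' = b /\ b' = a).
Proof.
move=> E; have := set21 a b; have := set22 a b; rewrite {1 2}E !inE.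
have := set21 a' b'; have := set22 a' b'; rewrite -{1 2}E !inE.
by do 4 (case/orP=> /eqP ?); subst; auto.
Qed.

Lemma boundary_edge_inj f f' i i' : (i < n)%N -> (i' < n)%N -> col f = col f' ->
  [set cf f i; cf f i.+1]%SET = [set cf f' i'; cf f' i'.+1]%SET ->
  f = f' /\ i = i'.
Proof.
move=> i_n i_n' ff' /set2_eq ii'.
have fi : (cf f i = cf f i /\ cf f i.+1 = cf f i.+1) \/
    (cf f i = cf f i.+1 /\ cf f i.+1 = cf f i) by left.
have [_ _ -> E] := face_col_inj ff' fi ii'; split=> //.
by move: E; rewrite !modn_small.
Qed.

Lemma boundary_circuit f : circuit e (boundary f).
Proof.
have n4 : (4 < n)%N by rewrite -(kF f).
apply/and3P; split.
- by rewrite -size_eq0 size_mkseq; case: n n4.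
- rewrite cycle_zip zip_rot1_mkseq; last exact: cfDn.
  by apply/allP => _ /mapP[j _ ->]; exact: face_adj.
rewrite boundary_edges map_inj_in_uniq ?iota_uniq // => i j.
rewrite !mem_iota !add0n /= => i_n jn ij.
by have [] := boundary_edge_inj i_n jn erefl ij.
Qed.

Definition boundaries (b : bool) : seq (seq V) :=
  [seq boundary f | f <- enum F & col f == b].

Lemma boundaries_decomposition b : circuit_decomposition e (boundaries b).
Proof.
apply/andP; split; first by apply/allP => _ /mapP[f _ ->]; exact: boundary_circuit.
have -> : flatten (map (@circuit_edges V) (boundaries b)) =
    [seq [set cf f j; cf f j.+1]%SET | f <- [seq f <- enum F | col f == b], j <- iota 0 n].
  rewrite /boundaries -map_comp; congr flatten; apply: eq_map => f.
  exact: boundary_edges.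
apply: uniq_perm; rewrite ?enum_uniq //.
  apply: allpairs_uniq; first by rewrite filter_uniq // enum_uniq.
    exact: iota_uniq.
  move=> _ _ /allpairsP[[f i] [/= + + ->]] /allpairsP[[f' i'] [/= + + ->]] /=.
  rewrite !mem_filter !mem_iota !add0n /= => /andP[/eqP fb _] i_n /andP[/eqP fb' _] in' E.
  by have [-> ->] := boundary_edge_inj i_n in' (etrans fb (esym fb')) E.
move=> E; rewrite mem_enum; apply/allpairsP/imsetP.
  move=> [[f i] /= [_ _ ->]]; exists (cf f i, cf f i.+1) => //.
  by rewrite inE /=; exact: face_adj.
move=> [[u v]]; rewrite inE /= => uv ->.
(* Symmetry of e: the triangle on the left of the arc, seen from v, has u as a corner. *)
have vu : e v u.
  have [f [i [<- <-]]] := arc_face uv; apply/adjP.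
  have [l [h1 h2]] := face_arc f i; have [l' ] := c_tri (inl (cf f i)) l.
  by rewrite h1 h2 => -[h3 h4]; exists l'.+1.
have arc u' v' : e u' v' -> dir u' v' = b -> exists p : F * nat,
    [/\ p.1 \in [seq f <- enum F | col f == b], p.2 \in iota 0 n &
        [set u'; v']%SET = [set cf p.1 p.2; cf p.1 p.2.+1]%SET].
  move=> uv' d; have [f [i [h1 h2]]] := arc_face uv'.
  have n0 : (0 < n)%N by rewrite -(kF f); apply: leq_ltn_trans (k_gt4 _).
  have [cfm1 cfm2] : cf f (i %% n) = cf f i /\ cf f (i %% n).+1 = cf f i.+1.
    have E1 : (i %% n)%N = i %[mod n] by rewrite modn_mod.
    split; apply: (@inl_inj V F); rewrite -!cF; apply: c_mod => //; rewrite kF //.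
    exact: modn_succ.
  exists (f, (i %% n)%N); split => /=.
  - by rewrite mem_filter mem_enum andbT -(dir_col f i) h1 h2 d.
  - by rewrite mem_iota add0n ltn_mod.
  - by rewrite cfm1 cfm2 h1 h2.
(* Exactly one of the arcs uv and vu has the direction b, and the face to its left has that
   colour. *)
have [d|/eqP d] := eqVneq (dir u v) b; first exact: arc uv d.
rewrite finset.setUC; apply: arc => //.
by rewrite (dir_anti uv); move/eqP: d; case: (dir u v); case: b.
Qed.

Lemma graph_biembedding : biembedding e graph_map.
Proof.
exists (boundaries true), (boundaries false); split; try exact: boundaries_decomposition.
split; first exact: graph_embedding.
have cls b : color_class_is e graph_map face_color b (boundaries b).
  split=> [_ /faceP[f ->]|_ /mapP[f + ->]].
    rewrite face_colorE => fb; exists (boundary f); last exact: star_bounded_by.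
    by apply/map_f; rewrite mem_filter fb eqxx mem_enum.
  rewrite mem_filter => /andP[/eqP fb _]; exists (star (inr f)); split.
  - by apply/faceP; exists f.
  - by rewrite face_colorE.
  - exact: star_bounded_by.
by exists face_color; split; [exact: graph_face_coloring|exact: cls|exact: cls].
Qed.

Lemma biembedding_of_links : exists (T : topologicalType) (phi : {ptws V -> R} -> T),
  [/\ surface R T, orientable R T, cellular e phi, biembedding e phi &
      forall A : set T, face e phi A -> face_length e phi A n].
Proof.
exists S, graph_map; split.
- exact: (complex_surface R k_gt4 c_eq c_neq c_tri simplex_hub).
- exact: (complex_orientable R k_gt4 c_eq c_neq c_tri (inl v0)).
- exact: graph_cellular.
- exact: graph_biembedding.
move=> _ /faceP[f ->]; exists (boundary f); split.
- exact: boundary_circuit.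
- exact: star_bounded_by.
- by rewrite size_mkseq.
Qed.

End GraphOnComplex.

(** * Links for the tripartite graph *)

Lemma inl_pair_inj (A B C : Type) (a a' : A) (b b' : B) :
  inl C (a, b) = inl C (a', b') -> a = a' /\ b = b'.
Proof. by case. Qed.

Lemma inr_pair_inj (A B C : Type) (a a' : A) (b b' : B) :
  inr C (a, b) = inr C (a', b') -> a = a' /\ b = b'.
Proof. by case. Qed.

(* Links are periodic patterns of 4 or 3 vertices, so that an index s E + r
   (s = 4 or 3, r < s) is given by the pair (E, r), with E modulo m. The face
   (true, d) is B_d and (false, d) is W_d. *)
Section ExplicitLinks.
Variable p : nat.
Local Notation m := p.+2.
Hypothesis m_odd : odd m.
Local Notation Z := 'I_m.
Local Notation V := ('I_3 * 'I_m)%type.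
Local Notation F := (bool * 'I_m)%type.

Local Notation i0 := (@Ordinal 3 0 isT).
Local Notation i1 := (@Ordinal 3 1 isT).
Local Notation i2 := (@Ordinal 3 2 isT).

(** In each block: the head of an outgoing arc, the B on that arc, the tail of the arc by which this
    B arrives, and the W sharing the incoming arc. The index d of B is -E, 2E or -E for the parts 0,
    1, 2. *)
Definition vertex_block (u : V) (E : Z) (r : nat) : V + F :=
  let x := u.2 in
  match val u.1, r with
  | 0, 0 => inl (i1, x - E)
  | 0, 1 => inr (true, - E)
  | 0, 2 => inl (i2, x - 1 - 2 * E)
  | 0, _ => inr (false, - E - 1)
  | 1, 0 => inl (i2, x + 2 * E)
  | 1, 1 => inr (true, 2 * E)
  | 1, 2 => inl (i0, x - 2 * E)
  | 1, _ => inr (false, 2 * E)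
  | _, 0 => inl (i0, x + 2 * E + 1)
  | _, 1 => inr (true, - E)
  | _, 2 => inl (i1, x + E)
  | _, _ => inr (false, - E - 2)
  end.

(** The W's run backwards, hence the sign of E. Before (0, -E) on W_d come the vertices of parts 2
    and 1 with y = -E - 1, which gives the constants 2d + 1 and d - 1. *)
Definition face_block (f : F) (E : Z) (r : nat) : V :=
  let d := f.2 in
  match f.1, r with
  | true, 0 => (i0, E)
  | true, 1 => (i1, E + d)
  | true, _ => (i2, E + 2 * d)
  | false, 0 => (i0, - E)
  | false, 1 => (i2, 2 * d + 1 - E)
  | false, _ => (i1, d - 1 - E)
  end.

Definition face_cycle (f : F) (i : nat) : V :=
  face_block f (i %/ 3)%:R (i %% 3).

Definition link (w : V + F) (i : nat) : V + F :=
  match w with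
  | inl u => vertex_block u (i %/ 4)%:R (i %% 4)
  | inr f => inl (face_cycle f i)
  end.

Definition link_size (w : V + F) : nat := if w is inl _ then 4 * m else 3 * m.

Definition block_size (w : V + F) : nat := if w is inl _ then 4 else 3.

Definition block (w : V + F) (E : Z) (r : nat) : V + F :=
  match w with
  | inl u => vertex_block u E r
  | inr f => inl (face_block f E r)
  end.

Lemma linkE w i :
  link w i = block w (i %/ block_size w)%:R (i %% block_size w).
Proof. by case: w. Qed.

Lemma block_size_gt0 w : (0 < block_size w)%N. Proof. by case: w. Qed.

Definition next_index s (q : Z * nat) : Z * nat :=
  if (q.2.+1 < s)%N then (q.1, q.2.+1) else (q.1 + 1, 0%N).

Lemma link_block w E r : (r < block_size w)%N ->
  link w (val E * block_size w + r) = block w E r.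
Proof.
move=> rs; rewrite linkE divnMDl ?block_size_gt0 // modnMDl divn_small // modn_small //.
by rewrite addn0 natr_Zp.
Qed.

Lemma link_succ w i : let q := next_index (block_size w)
    ((i %/ block_size w)%:R, i %% block_size w)%N in
  link w i.+1 = block w q.1 q.2.
Proof.
have s0 := block_size_gt0 w; rewrite /= /next_index /=.
set q := (i %/ _)%N; set r := (i %% _)%N.
have rs : (r < block_size w)%N by rewrite ltn_mod.
have iE : i = (q * block_size w + r)%N := divn_eq _ _.
case: ifP => rs1.
  by rewrite linkE iE -addnS divnMDl // modnMDl divn_small // modn_small // addn0.
have {rs1}rE : r.+1 = block_size w by apply/eqP; rewrite eqn_leq rs leqNgt rs1.
rewrite linkE iE -addnS rE divnMDl // modnMDl divnn s0 modnn.
by rewrite natrD.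
Qed.

Lemma ord3P (a : 'I_3) : [\/ a = i0, a = i1 | a = i2].
Proof.
case: a => [[|[|[|//]]] h]; [constructor 1|constructor 2|constructor 3]; exact: val_inj.
Qed.

Lemma half_exists : exists h : Z, forall x : Z, 2 * (h * x) = x.
Proof.
(* (m + 1) / 2 is the inverse of 2 modulo the odd number m. *)
exists (uphalf m)%:R => x; rewrite mulrA -natrM mul2n.
have -> : ((uphalf m).*2 = m + 1)%N.
  by rewrite uphalf_half m_odd doubleD addnC -[in RHS](odd_double_half m) m_odd; lia.
rewrite natrD (_ : m%:R = 0 :> Z) ?add0r ?mul1r //.
by rewrite Zp_nat; apply/val_inj; rewrite /= modnn.
Qed.


(** The triangle condition in block coordinates, where it becomes ring identities: E' solves the
    linear equation locating the next entry in the link of a. The division by 2 occurs only when a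
    is a vertex of part 1, around which d advances by 2. *)
Lemma tri_block w E r : (r < block_size w)%N ->
  exists E' r', let a := block w E r in
    let q := next_index (block_size w) (E, r) in
    let q' := next_index (block_size a) (E', r') in
    [/\ (r' < block_size a)%N, block a E' r' = block w q.1 q.2 &
        block a q'.1 q'.2 = w].
Proof.
have [h hK] := half_exists.
case: w => [[a x]|[b d]] /=.
  have [->|->|->] := ord3P a; case: r => [|[|[|[|//]]]] _ /=.
  - exists (h * - E), 1; rewrite /block /vertex_block /= !hK.
    by split=> //; congr (inl (_, _)); ring.
  - exists (x - 1), 2; rewrite /block /vertex_block /face_block /=.
    by split=> //; congr (inl (_, _)); ring.
  - exists (E - 1), 3; rewrite /block /vertex_block /face_block /=.
    by split=> //; [congr (inr (_, _)); ring|congr (inl (_, _)); ring].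
  - exists (- x - 1), 2; rewrite /block /vertex_block /face_block /=.
    by split=> //; congr (inl (_, _)); ring.
  - exists (- (2 * E)), 1; rewrite /block /vertex_block /face_block /=.
    by split=> //; [congr (inr (_, _)); ring|congr (inl (_, _)); ring].
  - exists (x - 2 * E), 0; rewrite /block /vertex_block /face_block /=.
    by split=> //; congr (inl (_, _)); ring.
  - exists (- (2 * E) - 1), 3; rewrite /block /vertex_block /face_block /=.
    by split=> //; [congr (inr (_, _)); ring|congr (inl (_, _)); ring].
  - exists (2 * E - 1 - x), 1; rewrite /block /vertex_block /face_block /=.
    by split=> //; congr (inl (_, _)); ring.
  - exists E, 1; rewrite /block /vertex_block /face_block /=.
    by split=> //; congr (inl (_, _)); ring.
  - exists (x + 2 * E), 1; rewrite /block /vertex_block /face_block /=.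
    by split=> //; congr (inl (_, _)); ring.
  - exists (h * (- E - 2)), 3; rewrite /block /vertex_block /face_block /= (mulrDr 2) hK.
    by split=> //; congr (inl (_, _)); ring.
  - exists (- (x + 2 * E + 3)), 0; rewrite /block /vertex_block /face_block /=.
    by split=> //; congr (inl (_, _)); ring.
case: b; case: r => [|[|[|//]]] _ /=.
- exists (- d), 0; rewrite /block /vertex_block /face_block /=.
  by split=> //; [congr (inl (_, _)); ring|congr (inr (_, _)); ring].
- exists (h * d), 0; rewrite /block /vertex_block /face_block /= hK.
  by split=> //; congr (inl (_, _)); ring.
- exists (- d), 0; rewrite /block /vertex_block /face_block /=.
  by split=> //; [congr (inl (_, _)); ring|congr (inr (_, _)); ring].
- exists (- d - 1), 2; rewrite /block /vertex_block /face_block /=.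
  by split=> //; [congr (inl (_, _)); ring|congr (inr (_, _)); ring].
- exists (- d - 2), 2; rewrite /block /vertex_block /face_block /=.
  by split=> //; [congr (inl (_, _)); ring|congr (inr (_, _)); ring].
- exists (h * d), 2; rewrite /block /vertex_block /face_block /= hK.
  by split=> //; congr (inl (_, _)); ring.
Qed.

Lemma link_tri w i : exists l, link (link w i) l = link w i.+1 /\
  link (link w i) l.+1 = w.
Proof.
have s0 := block_size_gt0 w.
have rs : (i %% block_size w < block_size w)%N by rewrite ltn_mod.
have [E' [r' [r's h1 h2]]] := tri_block (i %/ block_size w)%:R rs.
rewrite link_succ -h1 linkE; set a := block w _ _ in h1 h2 r's *.
exists (val E' * block_size a + r')%N; split; first exact: link_block.
rewrite link_succ divnMDl ?block_size_gt0 // modnMDl divn_small // modn_small //.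
by rewrite addn0 natr_Zp.
Qed.

(** In each slot of a block, E enters with slope 1, -1, 2 or -2, all invertible modulo m. *)
Lemma affine_inj (x y E E' : Z) : x = y ->
  [\/ x - y = E - E', x - y = E' - E, x - y = 2 * (E - E') |
      x - y = 2 * (E' - E)] -> E = E'.
Proof.
have [h hK] := half_exists.
have two0 (z : Z) : 2 * z = 0 -> z = 0 by move=> z0; rewrite -(hK z) mulrCA z0 mulr0.
move=> ->; rewrite subrr => -[] /esym; last 2 first.
- by move/two0/subr0_eq.
- by move/two0/subr0_eq.
- by move/subr0_eq.
- by move/subr0_eq.
Qed.

Lemma block_inj w E r E' r' : (r < block_size w)%N -> (r' < block_size w)%N ->
  block w E r = block w E' r' -> E = E' /\ r = r'.
Proof.
case: w => [[a x]|[b d]] /=.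
  by have [->|->|->] := ord3P a; case: r => [|[|[|[|//]]]] _;
    case: r' => [|[|[|[|//]]]] _; rewrite /vertex_block /=;
    first [by [] | move=> B; have := inl_pair_inj B | move=> B; have := inr_pair_inj B];
    case=> // _ H;
    split=> //; apply: (affine_inj H);
    first [constructor 1; ring | constructor 2; ring
          | constructor 3; ring | constructor 4; ring].
by case: b; case: r => [|[|[|//]]] _; case: r' => [|[|[|//]]] _;
  rewrite /face_block /= => B; have := inl_pair_inj B; case=> // _ H;
  split=> //; apply: (affine_inj H);
  first [constructor 1; ring | constructor 2; ring
        | constructor 3; ring | constructor 4; ring].
Qed.

Lemma link_sizeE w : link_size w = (block_size w * m)%N. Proof. by case: w. Qed.

Lemma eqn_mod_mul s i j : (0 < s)%N -> (i == j %[mod s * m]) =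
  ((i %/ s)%:R == (j %/ s)%:R :> Z) && (i %% s == j %% s)%N.
Proof.
move=> s0.
have decomp a : (a %% (s * m) = (a %/ s %% m) * s + a %% s)%N.
  rewrite {1}(divn_eq a s) {1}(divn_eq (a %/ s) m) mulnDl -mulnA (mulnC m) -addnA modnMDl.
  rewrite modn_small //.
  apply: (@leq_trans ((a %/ s %% m).+1 * s)).
    by rewrite mulSn addnC ltn_add2r ltn_mod.
  by rewrite mulnC leq_mul2l ltn_mod orbT.
rewrite !decomp -[X in _ = X && _](inj_eq val_inj) !Zp_nat /=.
apply/eqP/andP => [E|[/eqP-> /eqP->]//].
have := congr1 (fun a => a %/ s)%N E; have := congr1 (fun a => a %% s)%N E.
rewrite !modnMDl !modn_mod !divnMDl // !(divn_small (m := _ %% s)) ?ltn_mod //.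
by rewrite !addn0 => -> ->.
Qed.

Lemma link_eq w i j : (link w i == link w j) = (i == j %[mod link_size w]).
Proof.
have s0 := block_size_gt0 w.
rewrite link_sizeE eqn_mod_mul // !linkE; apply/eqP/andP.
  by move=> /block_inj[] //; rewrite ?ltn_mod // => -> ->.
by move=> [/eqP-> /eqP->].
Qed.

Lemma link_neq w i : link w i != w.
Proof.
case: w => [[a x]|f]; rewrite linkE //=.
have := @ltn_pmod i 4 isT; case: (i %% 4)%N => [|[|[|[|//]]]] _;
  by have [->|->|->] := ord3P a.
Qed.

Lemma link_size_gt4 w : (4 < link_size w)%N.
Proof. by case: w => ?; rewrite /link_size mulnC. Qed.

Lemma adjacent_link (u v : V) :
  complete_multipartite u v <-> exists i, link (inl u) i = inl v.
Proof.
have [h hK] := half_exists; split; last first.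
  move=> [i]; rewrite linkE /=; case: u v => [a x] [b y].
  rewrite /complete_multipartite /=.
  have := @ltn_pmod i 4 isT; case: (i %% 4)%N => [|[|[|[|//]]]] _;
  by have [->|->|->] := ord3P a; rewrite /vertex_block //= => -[<- _].
case: u v => [a x] [b y]; rewrite /complete_multipartite /=.
have at_block E r : (r < 4)%N -> vertex_block (a, x) E r = inl (b, y) ->
    exists i, link (inl (a, x)) i = inl (b, y).
  move=> r4 E1; exists (val E * 4 + r)%N.
  exact: etrans (@link_block (inl (a, x)) E r r4) E1.
(* Neighbours in the next part, cyclically, sit in slot 0 and those in the previous part in slot 2;
   the first argument solves the entry for E. *)
have [aE|aE|aE] := ord3P a; have [bE|bE|bE] := ord3P b; subst a b => // _.
- by apply: (at_block (x - y) 0) => //; rewrite /vertex_block /=; congr (inl (_, _)); ring.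
- apply: (at_block (h * (x - 1 - y)) 2) => //; rewrite /vertex_block /= hK.
  by congr (inl (_, _)); ring.
- apply: (at_block (h * (x - y)) 2) => //; rewrite /vertex_block /= hK.
  by congr (inl (_, _)); ring.
- apply: (at_block (h * (y - x)) 0) => //; rewrite /vertex_block /= hK.
  by congr (inl (_, _)); ring.
- apply: (at_block (h * (y - x - 1)) 0) => //; rewrite /vertex_block /= hK.
  by congr (inl (_, _)); ring.
- by apply: (at_block (y - x) 2) => //; rewrite /vertex_block /=; congr (inl (_, _)); ring.
Qed.

Lemma link_vertex_face (u v : V) i : link (inl u) i = inl v ->
  exists f, link (inl u) i.+1 = inr f.
Proof.
rewrite link_succ linkE /=; case: u => [a x].
have := @ltn_pmod i 4 isT; case: (i %% 4)%N => [|[|[|[|//]]]] _;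
  have [->|->|->] := ord3P a; rewrite /vertex_block //= => _; by eexists.
Qed.

Definition forward (u v : V) : bool := val v.1 == ((val u.1).+1 %% 3)%N.

Lemma forward_anti (u v : V) : complete_multipartite u v ->
  forward v u = ~~ forward u v.
Proof.
case: u v => [a x] [b y]; rewrite /complete_multipartite /forward /=.
by have [->|->|->] := ord3P a; have [->|->|->] := ord3P b.
Qed.

Lemma forward_face (f : F) i : forward (face_cycle f i) (face_cycle f i.+1) = f.1.
Proof.
have [] : face_cycle f i = face_block f (i %/ 3)%:R (i %% 3) /\
  inl (face_cycle f i.+1) = link (inr f) i.+1 by [].
rewrite link_succ /= => -> [->].
have := @ltn_pmod i 3 isT; case: (i %% 3)%N => [|[|[|//]]] _;
  by case: f => [[] d].
Qed.

(** A vertex common to all faces, which makes the surface connected. *)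
Lemma face_hub (f : F) : face_cycle f 0 = (i0, 0).
Proof. by case: f => [[] d]; rewrite /face_cycle /face_block //= oppr0. Qed.

End ExplicitLinks.

Lemma tripartite_biembedding (R : realType) (m : nat) : (1 < m)%N -> odd m ->
  exists (S : topologicalType) (phi : {ptws ('I_3 * 'I_m) -> R} -> S),
    [/\ surface R S, orientable R S,
        cellular (@complete_multipartite 3 m) phi,
        biembedding (@complete_multipartite 3 m) phi &
        forall A : set S, face (@complete_multipartite 3 m) phi A ->
          face_length (@complete_multipartite 3 m) phi A (3 * m)%N].
Proof.
(* The form [p.+2] provides the ring structure of the integers modulo m on the ordinals. *)
case: m => [|[|p]] // _ m_odd.
apply: (@biembedding_of_links R _ (bool * 'I_p.+2)%type (@link_size p) (@link p)
  (@link_size_gt4 p) (link_eq m_odd) (@link_neq p) (link_tri m_odd)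
  (3 * p.+2)%N (@face_cycle p) (@complete_multipartite 3 p.+2)
  (@forward p) fst (Ordinal (isT : 0 < 3)%N, 0)).
- by [].
- by [].
- exact: adjacent_link.
- exact: link_vertex_face.
- exact: forward_anti.
- exact: forward_face.
- by move=> f; exists 0%N; exact: face_hub.
Qed.

Local Close Scope ring_scope.
Local Close Scope classical_set_scope.

Theorem proposition5p9 (R : realType) (n : nat) (n_prime : prime n)
    (n_odd : odd n) :
  exists (S : topologicalType)
         (phi : {ptws ('I_3 * 'I_(n ^ 2)) -> R} -> S),
    [/\ surface R S, orientable R S,
        cellular (@complete_multipartite 3 (n ^ 2)) phi,
        biembedding (@complete_multipartite 3 (n ^ 2)) phi &
        forall F : set S, face (@complete_multipartite 3 (n ^ 2)) phi F ->
          face_length (@complete_multipartite 3 (n ^ 2)) phi F (3 * n ^ 2) \/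
          face_length (@complete_multipartite 3 (n ^ 2)) phi F (3 * n ^ 3)].
Proof.
have n2_gt1 : (1 < n ^ 2)%N by rewrite (ltn_exp2l 0) // prime_gt1.
have n2_odd : odd (n ^ 2) by rewrite oddX.
have [S [phi [h1 h2 h3 h4 h5]]] := tripartite_biembedding R n2_gt1 n2_odd.
by exists S, phi; split=> // A /h5; left.
Qed.
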